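(* Let $T$ be the tree of all subsets of $\mathbb{Q}$ that are well ordered by the usual order of the real line, ordered by end-extension ($t\le s$ if $t$ is an initial segment of $s$). Then the space $L\subset 2^T$ defined by $T$ is a Boolean image of a path-connected compact space, but it is not a Boolean image of any compact convex set.
   Context: All compact spaces are Hausdorff and nonempty; ''zero-dimensional'' means having a base of clopen sets. ''Compact convex set'' means a compact convex subset of $\mathbb{R}^\Gamma$ for some set $\Gamma$. For a tree $T$, let $\bar T$ be the family of all subsets of $T$ that are either initial segments $\{t\in T: t<s\}$, $s\in T$, or full branches (maximal chains) of $T$. The space defined by $T$ is the compact zero-dimensional space $L=\{x\in 2^T: \{t\in T: x_t=1\}\in\bar T\}\subset 2^T$. A pseudoclopen of a compact space $K$ is a pair $a=(a^-,a^+)$ with $a^-\subset K$ closed, $a^+\subset K$ open and $a^-\subset a^+$. Let $\mathcal{G}$ be a family of subsets of a nonempty set $X$. A bijection $\phi$ from $\mathcal{G}$ onto a family of pseudoclopens of $K$ is an isomorphism if for all $n,m\ge 0$ and all distinct $a_1,\ldots,a_n,b_1,\ldots,b_m\in\mathcal{G}$: (1) if $\bigcap_{i\le n}a_i\setminus\bigcup_{j\le m}b_j=\emptyset$ then $\bigcap_{i\le n}\phi(a_i)^+\setminus\bigcup_{j\le m}\phi(b_j)^-=\emptyset$; (2) if $\bigcap_{i\le n}\phi(a_i)^-\setminus\bigcup_{j\le m}\phi(b_j)^+=\emptyset$ then $\bigcap_{i\le n}a_i\setminus\bigcup_{j\le m}b_j=\emptyset$. (Empty intersections are $X$, respectively $K$.)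 A zero-dimensional compact space $L$ is a Boolean image of a compact space $K$ if there is a family $\mathcal{G}$ of clopen subsets of $L$ (regarded as subsets of $X=L$) which separates the points of $L$ (for all $x\neq y$ in $L$ there is $a\in\mathcal{G}$ with $|a\cap\{x,y\}|=1$) and which is isomorphic to a family of pseudoclopens of $K$. *)

(* Defs.v *)
From HB Require Import structures.
From mathcomp Require Import all_boot all_order all_algebra.
From mathcomp Require Import all_classical all_reals all_analysis.
Import Order.TTheory GRing.Theory Num.Theory.
Import numFieldNormedType.Exports.

Set Implicit Arguments.
Unset Strict Implicit.
Unset Printing Implicit Defensive.

Local Open Scope classical_set_scope.
Local Open Scope ring_scope.

(* Compact spaces are Hausdorff and nonempty by convention. *)
Definition compact_space (K : topologicalType) : Prop :=
  [/\ compact [set: K], hausdorff_space K & [set: K] !=set0].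

(* The library's [zero_dimensional] only asks that clopen sets separate points. *)
Definition clopen_based (K : topologicalType) : Prop :=
  exists2 B : set (set K), B `<=` clopen & basis B.

Definition path_connected (R : realType) (K : topologicalType) : Prop :=
  forall x y : K, exists f : R -> K,
    [/\ {within `[0, 1], continuous f}, f 0 = x & f 1 = y].

Section BooleanImages.

(* The pair (a^-, a^+) is encoded as (a.1, a.2). *)
Definition pseudoclopen (K : topologicalType) (a : set K * set K) : Prop :=
  [/\ closed a.1, open a.2 & a.1 `<=` a.2].

(* Both families of indices may be empty, and \bigcap_i is then the whole
   space. *)
Definition isomorphism (X : Type) (K : topologicalType) (G : set (set X))
    (H : set (set K * set K)) (phi : set X -> set K * set K) : Prop :=
  set_bij G H phi /\
  forall (n m : nat) (a : 'I_n -> set X) (b : 'I_m -> set X),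
    (forall i, G (a i)) -> (forall j, G (b j)) ->
    injective a -> injective b -> (forall i j, a i <> b j) ->
    ((\bigcap_i a i) `\` (\bigcup_j b j) = set0 ->
     (\bigcap_i (phi (a i)).2) `\` (\bigcup_j (phi (b j)).1) = set0) /\
    ((\bigcap_i (phi (a i)).1) `\` (\bigcup_j (phi (b j)).2) = set0 ->
     (\bigcap_i a i) `\` (\bigcup_j b j) = set0).

Definition separates_points (X : Type) (G : set (set X)) : Prop :=
  forall x y : X, x <> y ->
    exists2 a, G a & (a x /\ ~ a y) \/ (~ a x /\ a y).

Definition boolean_image (L K : topologicalType) : Prop :=
  exists G : set (set L),
    [/\ G `<=` clopen, separates_points G &
        exists (H : set (set K * set K)) (phi : set L -> set K * set K),
          H `<=` @pseudoclopen K /\ isomorphism G H phi].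

End BooleanImages.

Section Trees.
Context {d : Order.disp_t}.

Definition is_tree (T : porderType d) : Prop :=
  forall s : T, wochoice.wo_chain <=%O (mem [set t | (t < s)%O]).

Variable T : porderType d.

Definition is_chain (A : set T) : Prop := total_on A (fun s t => (s <= t)%O).

Definition full_branch (A : set T) : Prop :=
  is_chain A /\ forall B, is_chain B -> A `<=` B -> B = A.

Definition bar_tree : set (set T) :=
  [set A | (exists s, A = [set t | (t < s)%O]) \/ full_branch A].

(* Only meant for posets satisfying [is_tree]. *)
Definition tree_space : set {ptws T -> bool} :=
  [set x | bar_tree [set t | x t = true]].

End Trees.
Arguments tree_space {d} T.

(* [wo_chain R A]: every nonempty subset of A has a unique R-minimum; the
   empty set belongs to wo_rat and is the root of the tree. *)
Definition wo_rat : Type :=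
  set_type [set A : set rat | wochoice.wo_chain <=%R (mem A)].

Definition elements (t : wo_rat) : set rat := \val t.

Definition end_extension (t s : wo_rat) : Prop :=
  elements t `<=` elements s /\
  forall x y, elements t y -> elements s x -> x <= y -> elements t x.

Definition wo_rat_le (t s : wo_rat) : bool := `[< end_extension t s >].

Lemma wo_rat_le_refl : reflexive wo_rat_le.
Proof. by move=> t; apply/asboolP; split. Qed.

Lemma wo_rat_le_anti : antisymmetric wo_rat_le.
Proof.
move=> t s /andP[/asboolP[ts _] /asboolP[st _]].
by apply: val_inj; apply/seteqP.
Qed.

Lemma wo_rat_le_trans : transitive wo_rat_le.
Proof.
move=> s t u /asboolP[ts its] /asboolP[su isu]; apply/asboolP; split.
  exact: subset_trans ts su.
move=> x y ty ux xy; apply: (its x y) => //.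
by apply: (isu x y) => //; exact: ts.
Qed.

Fact wo_rat_display : Order.disp_t. Proof. exact: Order.Disp tt tt. Qed.

HB.instance Definition _ := Choice.on wo_rat.
HB.instance Definition _ := Order.Le_isPOrder.Build wo_rat_display wo_rat
  wo_rat_le_refl wo_rat_le_anti wo_rat_le_trans.

Lemma wo_rat_is_tree : is_tree wo_rat.
Proof.
move=> s; apply: wochoice.antisymmetric_wo_chain.
  by move=> t u _ _; exact: le_anti.
move=> A As [t0 At0].
have Ale t : t \in A -> end_extension t s.
  by move=> /As; rewrite inE => /= /ltW /asboolP.
pose D := [pred x : rat |
  `[< elements s x /\ exists2 t, t \in A & ~ elements t x >]].
have wos : wochoice.wo_chain <=%R (mem (elements s)).
  by have := valP s; rewrite inE.
have [|| x0 [[x0D minx0] _]] := wos D.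
- by move=> x /asboolP[sx _]; apply: mem_set.
- apply: contrapT => D0; have : (t0 < s)%O by have := As _ At0; rewrite inE.
  suff -> : t0 = s by rewrite ltxx.
  apply: val_inj; apply/seteqP; split; first exact: (Ale _ At0).1.
  move=> x sx; apply: contrapT => tx; apply: D0; exists x.
  by apply/asboolP; split => //; exists t0.
move: (x0D) => /asboolP[sx0 [t1 At1 t1x0]].
exists t1; split => // t At; apply/asboolP; split => [y t1y|x y t1y tx xy].
  have sy := (Ale _ At1).1 _ t1y; apply: contrapT => ty.
  have yD : y \in D by apply/asboolP; split => //; exists t.
  by apply: t1x0; apply: ((Ale _ At1).2 _ y) => //; exact: minx0.
by apply: ((Ale _ At1).2 _ y) => //; exact: (Ale _ At).1.
Qed.

(* Main.v *)
(** The sets of nodes carrying a regressive map with fibres that are countable unions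
    of antichains form a normal ideal of nodes, proper because the tree itself is not
    a countable union of antichains (Baire category); so pressing down is available.

    Path-connected image: let the last node of a branch carry a weight in [0, 1].
    These soft branches form a compact space, and [x t = 1] corresponds to the
    pseudoclopen ([f t = 1], [f t > 0]).  Since the nodes below [u] are ordered like a
    set of rationals, the weights of a soft branch can be lowered to 0 one after the
    other, from the top down, in one unit of time.

    No convex image: let [G] be isomorphic to a family of pseudoclopens of a convex
    [C].  Each cylinder at [t] depends on finitely many members of [G]; pressing down
    makes these finite sets a delta-system along chains of a stationary set [S].  Off
    the root of the system the cylinders yield open [P t] and closed [N t], with
    [N t] inside [P t] near a cluster point, [P t] inside [N s] for [s < t], and
    points [k t] in [N t] with [k s] outside [N t] unless [t <= s].  Work in a small
    convex box containing a fixed [p = k t0] and stationarily many [k t], and for each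
    such [t] contract the box towards [p]: there is a rational ratio at which the
    contracted box meets [P t] but not [N t].  Nodes with the same ratio are
    incomparable, so a stationary set is a countable union of antichains. *)

Require Import Defs.
From HB Require Import structures.
From mathcomp Require Import all_boot all_order all_algebra.
From mathcomp Require Import all_classical all_reals all_analysis.
From mathcomp Require Import lra ring.
Import Order.TTheory GRing.Theory Num.Theory.
Import numFieldNormedType.Exports.

Set Implicit Arguments.
Unset Strict Implicit.
Unset Printing Implicit Defensive.

Local Open Scope classical_set_scope.
Local Open Scope ring_scope.

(** * Trees: bar families, nonstationary sets and pressing down *)

Section TreeTheory.
Context {d : Order.disp_t} {T : porderType d}.
Hypothesis treeT : is_tree T.

Lemma tree_ex_min (A : set T) (a : T) : A a ->
  exists m, [/\ A m, (m <= a)%O & forall s, (s < m)%O -> ~ A s].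
Proof.
move=> Aa; have [[s sa As]|no] := pselect (exists2 s, (s < a)%O & A s); last first.
  by exists a; split=> // s sa As; apply: no; exists s.
have [||m [[mD minm] _]] := treeT (s := a) (A := [pred x | `[< (x < a)%O /\ A x >]]).
- by move=> x /asboolP[xa _]; apply: mem_set.
- by exists s; apply/asboolP.
move: mD => /asboolP[ma Am]; exists m; split=> // [|x xm Ax]; first exact: ltW.
have : (m <= x)%O by apply: minm; apply/asboolP; split=> //; exact: lt_trans ma.
by move=> /le_lt_trans/(_ xm); rewrite ltxx.
Qed.

Lemma tree_ind (P : T -> Prop) :
  (forall t, (forall s, (s < t)%O -> P s) -> P t) -> forall t, P t.
Proof.
move=> IH t; apply: contrapT => nPt.
have [m [nPm _ minm]] := @tree_ex_min (fun t => ~ P t) t nPt.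
by apply: nPm; apply: IH => s sm; apply: contrapT; exact: minm.
Qed.

Lemma tree_comparable (s t u : T) : (s <= u)%O -> (t <= u)%O -> (s >=< t)%O.
Proof.
rewrite !le_eqVlt => /predU1P[->|su] /predU1P[->|tu].
- exact: comparablexx.
- by rewrite /Order.comparable (ltW tu) orbT.
- by rewrite /Order.comparable (ltW su).
have [||m [[mD minm] _]] := treeT (s := u) (A := pred2 s t).
- by move=> x /pred2P[]->; apply: mem_set.
- by exists s; rewrite inE eqxx.
have ms : (m <= s)%O by apply: minm; rewrite inE eqxx.
have mt : (m <= t)%O by apply: minm; rewrite inE eqxx orbT.
by move/pred2P: mD ms mt => [] -> ms mt; rewrite /Order.comparable ?ms ?mt ?orbT.
Qed.

Definition down_closed (A : set T) := forall s t, (s <= t)%O -> A t -> A s.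

(** If a downward closed chain is not maximal, a larger chain contains a node outside it, and a
    minimal missed node has exactly the given chain as its predecessors. The conditions on the right
    only involve pairs of nodes, hence pairs of coordinates. *)
Lemma bar_treeP (A : set T) : bar_tree A <-> is_chain A /\ down_closed A.
Proof.
split=> [[[s ->]|[cA maxA]]|[cA dA]].
- split=> [t u ts us|t u tu us]; last exact: le_lt_trans us.
  by apply/orP; apply: (tree_comparable (ltW ts) (ltW us)).
- split=> // s t st At; suff <- : A `|` [set s] = A by right.
  apply: maxA => [x y|x Ax]; last by left.
  have sA z : A z -> (z <= s)%O \/ (s <= z)%O.
    move=> Az; have [zt|tz] := cA _ _ Az At; last by right; exact: le_trans tz.
    exact/orP/(tree_comparable zt st).
  move=> [Ax|->] [Ay|->]; [exact: cA|exact: sA| |by left].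
  by have [] := sA _ Ay; [right|left].
have [mA|] := pselect (forall B, is_chain B -> A `<=` B -> B = A).
  by right.
move=> /existsNP[B /not_implyP[cB /not_implyP[AB nBA]]]; left.
have [s Bs nAs] : exists2 s, B s & ~ A s.
  apply: contrapT => no; apply: nBA; apply/seteqP; split=> // s Bs.
  by apply: contrapT => nAs; apply: no; exists s.
have [m [nAm ms minm]] := @tree_ex_min (~` A) s nAs.
exists m; apply/seteqP; split=> [t At|t tm]; last first.
  by apply: contrapT => nAt; exact: minm tm nAt.
have ts : (t <= s)%O.
  by have [//|st] := cB _ _ (AB _ At) Bs; case: nAs; exact: dA At.
have /orP[mt|] := tree_comparable ms ts; first by case: nAm; exact: dA At.
by rewrite le_eqVlt => /predU1P[tm|//]; case: nAm; rewrite -tm.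
Qed.

(* The normal ideal of the tree: the sets carrying a regressive map whose fibres
   are countable unions of antichains, all coloured at once by [c]. *)
Definition nonstationary (S : set T) := exists (f : T -> T) (c : T -> nat),
  (forall t, S t -> (exists s, (s < t)%O) -> (f t < t)%O) /\
  (forall s t, S s -> S t -> (s < t)%O -> f s = f t -> c s <> c t).

(** The fibres of [c] on [S] are antichains, so [S] is a countable union of antichains. *)
Definition special (S : set T) := exists c : T -> nat,
  forall s t, S s -> S t -> (s < t)%O -> c s <> c t.

Lemma nonstationary_sub (S S' : set T) :
  S `<=` S' -> nonstationary S' -> nonstationary S.
Proof.
move=> SS' [f [c [fr cP]]]; exists f, c; split=> [t /SS'|s t /SS' ? /SS']; first exact: fr.
exact: cP.
Qed.

(** Each node follows the witnesses of one chosen [S n] containing it, and its colour also records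
    [n]; nodes of one colour then share their witnesses. *)
Lemma nonstationary_bigcup (S : nat -> set T) :
  (forall n, nonstationary (S n)) -> nonstationary (\bigcup_n S n).
Proof.
move=> /choice[f /choice[c fc]].
have /choice[n nP] t : exists n, (exists i, S i t) -> S n t.
  by have [[i Si]|no] := pselect (exists i, S i t); [exists i|exists 0%N].
exists (fun t => f (n t) t), (fun t => pickle (n t, c (n t) t)); split=> [t [i _ Si]|s t].
  by apply: (fc _).1; apply: nP; exists i.
move=> [i _ Si] [j _ Sj] st fst /(pcan_inj pickleK)[nst cst].
have Ss := nP s (ex_intro _ _ Si); have St := nP t (ex_intro _ _ Sj).
rewrite nst in Ss fst cst.
exact: (fc (n t)).2 cst.
Qed.

Lemma stationary_pigeonhole (I : countType) (S : set T) (c : T -> I) :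
  ~ nonstationary S -> exists i, ~ nonstationary (S `&` [set t | c t = i]).
Proof.
move=> nS; apply: contrapT => /forallNP no; apply: nS.
apply: (@nonstationary_sub _
    (\bigcup_n [set t | S t /\ pickle (c t) = n])); first by move=> t St; exists (pickle (c t)).
apply: nonstationary_bigcup => n.
have [[t0 tn]|none] := pselect (exists t0, pickle (c t0) = n).
  apply: (nonstationary_sub _ (contrapT (no (c t0)))) => t [St tn'].
  by split=> //=; apply: (pcan_inj pickleK); rewrite tn.
by exists id, (fun=> 0%N); split=> [t|s t] [_ tn]; case: none; eexists; exact: tn.
Qed.

Lemma stationaryD (S S' : set T) :
  ~ nonstationary S -> nonstationary S' -> ~ nonstationary (S `\` S').
Proof.
move=> nS NS' ND; apply: nS.
apply: (@nonstationary_sub _ (\bigcup_n (if n is 0 then S' else S `\` S'))).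
  move=> t St; have [S't|nS't] := pselect (S' t); first by exists 0%N.
  by exists 1%N.
by apply: nonstationary_bigcup => -[].
Qed.

Lemma nonstationaryU (S S' : set T) :
  nonstationary S -> nonstationary S' -> nonstationary (S `|` S').
Proof.
move=> NS NS'; apply: contrapT => /stationaryD/(_ NS'); apply.
by apply: nonstationary_sub NS => t [[]].
Qed.

Hypothesis countable_below : forall t : T, countable [set s | (s <= t)%O].

(** Normality of the ideal: if each fibre of [f] had witnesses [g r] and [c r], the larger [h t] of
    [f t] and [g (f t) t] would be regressive on [S]. Only countably many nodes lie below [h t], so
    a colour can record which of them are [f t] and [g (f t) t]. *)
Lemma pressing_down (S : set T) (f : T -> T) :
  ~ nonstationary S -> (forall t, S t -> (f t < t)%O) ->
  exists r, ~ nonstationary (S `&` [set t | f t = r]).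
Proof.
move=> nS fr; apply: contrapT => /forallNP no; apply: nS.
have /choice[g /choice[c gc]] r : nonstationary (S `&` [set t | f t = r]).
  exact: (contrapT (no r)).
have /choice[e eP] r : exists e : T -> nat,
    forall s t, (s <= r)%O -> (t <= r)%O -> e s = e t -> s = t.
  have /pcard_injP[e eP] := countable_below r.
  by exists e => s t sr tr; apply: eP; rewrite inE.
pose h t := if (f t <= g (f t) t)%O then g (f t) t else f t.
have gr t : S t -> (g (f t) t < t)%O.
  by move=> St; apply: (gc (f t)).1 => //; exists (f t); exact: fr.
have hP t : S t -> [/\ (h t < t)%O, (f t <= h t)%O & (g (f t) t <= h t)%O].
  move=> St; have := tree_comparable (ltW (fr _ St)) (ltW (gr _ St)).
  rewrite /h /Order.comparable; case: ifP => [->|_] /=; first by rewrite gr.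
  by move=> ->; rewrite fr.
exists h, (fun t => pickle (e (h t) (f t), e (h t) (g (f t) t), c (f t) t)); split.
  by move=> t St _; case: (hP t).
move=> s t Ss St st hst /(pcan_inj pickleK)[fst gst cst].
have [_ fs gs] := hP _ Ss; have [_ ft gt] := hP _ St.
rewrite -hst in fst gst ft gt.
have fE : f s = f t := eP _ _ _ fs ft fst.
have gE : g (f s) s = g (f t) t := eP _ _ _ gs gt gst.
by rewrite fE in gE cst; exact: (gc (f t)).2 cst.
Qed.

(** Iterating [f] leads from any node down to the root in finitely many steps, and the colours met
    on the way form a code of the node. By induction on the code, two nodes below a common node with
    the same code are equal. *)
Lemma nonstationary_setT (o : T) :
  (forall t, (o <= t)%O) -> nonstationary setT -> special setT.
Proof.
move=> ole [f [c [fr cP]]].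
pose code := fix code (l : seq nat) (t : T) {struct l} : Prop :=
  if l is n :: l' then [/\ t <> o, c t = n & code l' (f t)] else t = o.
have flt t : t <> o -> (f t < t)%O.
  by move=> /eqP to; apply: fr => //; exists o; rewrite lt_def to ole.
have /choice[l lP] t : exists l, code l t.
  move: t; apply: tree_ind => t IH; have [->|to] := pselect (t = o); first by exists [::].
  by have [l lP] := IH _ (flt _ to); exists (c t :: l).
have code_inj k : forall s t u, (s <= u)%O -> (t <= u)%O -> code k s -> code k t -> s = t.
  elim: k => [s t u _ _ -> ->//|n k IH s t u su tu [so sn ks] [to tn kt]].
  have fE : f s = f t.
    apply: (IH _ _ u) => //; apply/ltW; [exact: lt_le_trans (flt _ so) su|].
    exact: lt_le_trans (flt _ to) tu.
  apply: contrapT => /eqP st; have /orP[] := tree_comparable su tu.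
    rewrite le_eqVlt (negbTE st) => /cP/(_ fE); apply=> //.
    by rewrite sn.
  rewrite le_eqVlt eq_sym (negbTE st) => /cP/(_ (esym fE)); apply=> //.
  by rewrite sn.
exists (fun t => pickle (l t)) => s t _ _ st /(pcan_inj pickleK) ll.
suff E : s = t by rewrite E ltxx in st.
by apply: (@code_inj (l t) _ _ t); rewrite ?(ltW st) // -?ll.
Qed.

(** The constant map to the root is regressive, and [c] colours its single fibre. *)
Lemma special_nonstationary (o : T) (S : set T) :
  (forall t, (o <= t)%O) -> special S -> nonstationary S.
Proof.
move=> ole [c cP]; exists (fun=> o), c; split=> [t _ [s st]|s t Ss St st _].
  exact: le_lt_trans st.
exact: cP.
Qed.

End TreeTheory.

(** * The tree of well-ordered sets of rationals *)

Section WellOrderedRationals.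

Lemma wo_rat_leP (s t : wo_rat) : reflect (end_extension s t) (s <= t)%O.
Proof. exact: asboolP. Qed.

Lemma wo_rat_ex_min (t : wo_rat) (D : set rat) (x : rat) :
  D `<=` elements t -> D x -> exists m, D m /\ forall y, D y -> m <= y.
Proof.
move=> Dt Dx; have wot : wochoice.wo_chain <=%R (mem (elements t)).
  by have := valP t; rewrite inE.
have [|| m [[mD minm] _]] := wot [pred y | `[< D y >]].
- by move=> y /asboolP Dy; apply: mem_set; exact: Dt.
- by exists x; apply/asboolP.
exists m; split=> [|y Dy]; first exact/asboolP.
by apply: minm; exact/asboolP.
Qed.

Lemma wo_rat_build (A : set rat) :
  (forall (D : set rat) x, D `<=` A -> D x -> exists m, D m /\ forall y, D y -> m <= y) ->
  exists t : wo_rat, elements t = A.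
Proof.
move=> minA; have woA : A \in [set A : set rat | wochoice.wo_chain <=%R (mem A)].
  apply: mem_set; apply: wochoice.antisymmetric_wo_chain => [x y _ _|D DA [x xD]].
    exact: le_anti.
  have [|m [mD minm]] := minA [set` D] x _ xD; first by move=> y /DA; rewrite inE.
  by exists m; split=> // y; exact: minm.
by exists (SigSub woA).
Qed.

Lemma wo_rat_bot : exists o : wo_rat, forall t, (o <= t)%O.
Proof.
have [|o oE] := @wo_rat_build set0; first by move=> D x D0 /D0.
by exists o => t; apply/wo_rat_leP; split; rewrite oE.
Qed.

(** Take the least element [q] of [u] outside [t]; end-extension keeps all of [t] below it. Through
    [q] the nodes strictly below [u] are ordered like a set of rationals. *)
Lemma wo_rat_gap (t u : wo_rat) : (t < u)%O ->
  exists q, [/\ elements u q, ~ elements t q &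
                forall x, elements u x -> (elements t x <-> x < q)].
Proof.
rewrite lt_def => /andP[/eqP ut /wo_rat_leP[tu itu]].
have [x [ux ntx]] : elements u `\` elements t !=set0.
  apply: contrapT => no; apply: ut; apply: val_inj; apply/seteqP; split=> // x ux.
  by apply: contrapT => ntx; apply: no; exists x.
have [||q [[uq ntq] minq]] := @wo_rat_ex_min u (elements u `\` elements t) x.
- by move=> y [].
- by [].
exists q; split=> // y uy; split=> [ty|yq].
  by rewrite ltNge; apply/negP => qy; apply: ntq; exact: itu ty uq qy.
by apply: contrapT => nty; have := minq y (conj uy nty); rewrite leNgt yq.
Qed.

(** A node strictly below [u] is recovered from its gap [q], and the code [None] forces the node to
    be [u]. *)
Lemma wo_rat_countable_below (u : wo_rat) : countable [set t | (t <= u)%O].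
Proof.
have /choice[e eP] t : exists q : option rat, (t <= u)%O ->
    if q is Some q then forall x, elements t x <-> elements u x /\ x < q else t = u.
  rewrite le_eqVlt; have [->|_] := eqVneq t u; first by exists None.
  have [tu|ntu] := boolP (t < u)%O; last by exists None.
  have [q [uq ntq qP]] := wo_rat_gap tu.
  exists (Some q) => _ x; split=> [tx|[ux]]; last by move=> /(qP _ ux).
  have ux := (wo_rat_leP _ _ (ltW tu)).1 _ tx.
  by split=> //; apply/(qP _ ux).
apply/pcard_injP; exists (pickle \o e) => s t; rewrite !inE => su tu.
move=> /(pcan_inj pickleK) est; have := eP _ tu; have := eP _ su.
rewrite est; case: (e t) => [q sP tP|-> ->//].
apply: val_inj; apply/seteqP; split=> x; [move=> /sP /tP|move=> /tP /sP]; exact.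
Qed.

(** Members of a chain are initial segments of the union, so a minimum can be sought inside a single
    member. *)
Lemma wo_rat_sup (A : set wo_rat) : is_chain A ->
  exists u : wo_rat, elements u = \bigcup_(t in A) elements t /\
    forall t, A t -> (t <= u)%O.
Proof.
move=> cA.
have down t x y : A t -> elements t y -> (\bigcup_(t in A) elements t) x ->
    x <= y -> elements t x.
  move=> At ty [s As sx] xy.
  have [/wo_rat_leP[_ ist]|/wo_rat_leP[st _]] := cA _ _ At As; last exact: st.
  exact: ist ty sx xy.
have [|u uE] := @wo_rat_build (\bigcup_(t in A) elements t).
  move=> D x DA Dx; have [t At tx] := DA _ Dx.
  have [||m [[tm Dm] minm]] := @wo_rat_ex_min t (elements t `&` D) x.
  - by move=> y [].
  - by [].
  exists m; split=> // y Dy; rewrite leNgt; apply/negP => ym.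
  suff : m <= y by rewrite leNgt ym.
  by apply: minm; split=> //; apply: (down _ _ _ At tm) (ltW ym); exact: DA.
exists u; split=> // t At; apply/wo_rat_leP; rewrite /end_extension uE; split.
  by move=> x tx; exists t.
by move=> x y ty ux; exact: (down _ _ _ At ty).
Qed.

Lemma wo_rat_snoc (t : wo_rat) (q : rat) : (forall x, elements t x -> x < q) ->
  exists u : wo_rat, elements u = elements t `|` [set q] /\ (t < u)%O.
Proof.
move=> tq; have [|u uE] := @wo_rat_build (elements t `|` [set q]).
  move=> D x DA Dx; have [[y [ty Dy]]|no] := pselect (elements t `&` D !=set0).
    have [||m [[tm Dm] minm]] := @wo_rat_ex_min t (elements t `&` D) y.
    - by move=> z [].
    - by [].
    exists m; split=> // z Dz; have [tz|->] := DA _ Dz; first exact: minm.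
    exact/ltW/tq.
  have Dq z : D z -> z = q by move=> Dz; have [tz|//] := DA _ Dz; case: no; exists z.
  by exists x; split=> // z /Dq ->; rewrite (Dq _ Dx).
exists u; split=> //; rewrite lt_def; apply/andP; split.
  apply/eqP => ut; have : elements t q by rewrite -ut uE; right.
  by move=> /tq; rewrite ltxx.
apply/wo_rat_leP; rewrite /end_extension uE; split=> [x tx|x y ty [//|->]].
  by left.
by rewrite leNgt tq.
Qed.

(* Baire category: stage [n] takes a node of colour [n] whenever a bounded one is
   available, so the limit node [u] comes too late for its own colour. *)
Lemma wo_rat_not_special : ~ special [set: wo_rat].
Proof.
move=> [c cP].
pose below (t : wo_rat) (b : rat) := forall x, elements t x -> x < b.
(* A state is a node with rationals [a < b]: the node lies below [a], and all later nodes will stay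
   below [b]. *)
pose inv (p : wo_rat * (rat * rat)) := below p.1 p.2.1 /\ p.2.1 < p.2.2.
pose goes n (p p' : wo_rat * (rat * rat)) := [/\ inv p', (p.1 <= p'.1)%O, p'.2.2 < p.2.2 &
  (exists u a, [/\ (p.1 <= u)%O, below u a, a < p.2.2 & c u = n]) ->
  exists2 u, c u = n & (u < p'.1)%O].
have next n p : inv p -> exists p', goes n p p'.
  case: p => t [a b] [/= ta ab].
  have [[u [a' [tu ua' ab' cu]]]|no] := pselect (exists u a', [/\ (t <= u)%O,
      below u a', a' < b & c u = n]).
    have [v [vE uv]] := wo_rat_snoc ua'.
    have bE : b - a' > 0 by rewrite subr_gt0.
    (* [v] is [u] with [a'] added on top, so both new bounds lie strictly between [a'] and [b]. *)
    exists (v, (a' + (b - a') / 3, a' + (b - a') / 2)); split=> /=.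
    - split=> [x|] /=; last by lra.
      by rewrite vE => -[/ua' xa|->]; lra.
    - exact: le_trans tu (ltW uv).
    - lra.
    - by move=> _; exists u.
  exists (t, (a, (a + b) / 2)); split=> //=; [|lra].
  by split=> //=; lra.
have /choice[F FP] : forall np : nat * (wo_rat * (rat * rat)), exists p',
    inv np.2 -> goes np.1 np.2 p'.
  move=> [n p]; have [ip|nip] := pselect (inv p); last by exists p.
  by have [p' pp'] := next n p ip; exists p'.
have [rt rtle] := wo_rat_bot.
have rt0 x : ~ elements rt x.
  have [|e eE] := @wo_rat_build set0; first by move=> D y D0 /D0.
  by move=> ox; have /wo_rat_leP[rte _] := rtle e; have := rte _ ox; rewrite eE.
pose s := fix s (n : nat) := if n is n'.+1 then F (n', s n') else (rt, (0 : rat, 1 : rat)).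
have invs n : inv (s n).
  elim: n => [|n IH]; first by split=> //= x /rt0.
  by case: (FP (n, s n) IH).
have sP n : goes n (s n) (s n.+1) by exact: FP (n, s n) (invs n).
have homo_t m n : (m <= n)%N -> ((s m).1 <= (s n).1)%O.
  move=> /subnK <-; elim: (n - m)%N => [//|k IH].
  by apply: le_trans IH _; case: (sP (k + m)%N).
have homo_b m n : (m <= n)%N -> (s n).2.2 <= (s m).2.2.
  move=> /subnK <-; elim: (n - m)%N => [//|k IH].
  by apply: le_trans IH; case: (sP (k + m)%N) => _ _ /ltW.
have [|u [uE uP]] := @wo_rat_sup (range (fun n => (s n).1)).
  move=> _ _ [m _ <-] [n _ <-].
  by have [mn|/ltnW nm] := leqP m n; [left|right]; exact: homo_t.
have su n : ((s n).1 <= u)%O by apply: uP; exists n.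
(* The limit was eligible at stage [c u], since its elements lie below the bound fixed at the end of
   that stage; so a node of its colour was put strictly below it. *)
have [_ _ bm] := sP (c u); case.
  exists u, (s (c u).+1).2.2; split=> // x; rewrite uE => -[_ [n _ <-] nx].
  pose k := maxn n (c u).+1.
  have kx : elements (s k).1 x.
    by have /wo_rat_leP[nk _] := homo_t n k (leq_maxl _ _); exact: nk.
  have [kb ab] := invs k.
  apply: lt_le_trans (kb _ kx) _; apply: le_trans (ltW ab) _.
  exact/homo_b/leq_maxr.
move=> v cv vs; apply: (cP v u) => //.
exact: lt_le_trans vs (su _).
Qed.

End WellOrderedRationals.

(** * Compactness, products and subspaces *)

Section Compactness.

(** If no finite part sufficed, the finite intersections of the [F i] inside [K] and outside [U]
    would generate a proper filter; a cluster point would lie in every [F i] but not in [U]. *)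
Lemma compact_finite_sub (X : topologicalType) (I : eqType) (K : set X)
    (F : I -> set X) (U : set X) :
  compact K -> (forall i, closed (F i)) -> open U ->
  (forall x, K x -> (forall i, F i x) -> U x) ->
  exists s : seq I, forall x, K x -> (forall i, i \in s -> F i x) -> U x.
Proof.
move=> cK cF oU KFU; apply: contrapT => /forallNP no.
pose Phi : set_system X := [set A | exists s : seq I, forall x,
  K x -> (forall i, i \in s -> F i x) -> ~ U x -> A x].
have PhiF : ProperFilter Phi.
  split=> [[s s0]|].
    apply: (no s) => x Kx sx; apply: contrapT => nUx; exact: (s0 x).
  split=> [|A B [s sA] [r rB]|A B AB [s sA]]; first by exists [::].
    exists (s ++ r) => x Kx srx nUx; split.
      by apply: sA => // i si; apply: srx; rewrite mem_cat si.
    by apply: rB => // i ri; apply: srx; rewrite mem_cat ri orbT.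
  by exists s => x Kx sx nUx; apply: AB; exact: sA.
have [|p [Kp clp]] := cK Phi PhiF; first by exists [::].
have clE C : closed C -> Phi C -> C p.
  by move=> cC PC; apply: cC => B nB; exact: clp.
have : (~` U) p by apply: clE; [exact: open_closedC|exists [::]].
apply; apply: KFU => // i; apply: clE => //.
by exists [:: i] => x _ ix _; apply: ix; rewrite inE.
Qed.

Lemma set_type_compact (X : topologicalType) (A : set X) :
  compact A -> compact [set: set_type A].
Proof.
move=> cA F PF _.
have [|p [Ap clp]] := cA (set_val @ F) _.
  by rewrite /= /fmap/=; apply: filterE => x; exact: set_valP.
exists (SigSub (mem_set Ap)); split=> // B C FB [_ [[W oW <-] Wp WC]].
have [||y [[x Bx <-] Wx]] := clp (set_val @` B) W.
- by apply: (@filterS _ F _ B) FB => x Bx; exists x.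
- exact: open_nbhs_nbhs.
by exists x; split=> //; exact: WC.
Qed.

Lemma injective_hausdorff (X Y : topologicalType) (f : X -> Y) :
  continuous f -> injective f -> hausdorff_space Y -> hausdorff_space X.
Proof.
move=> cf fI hY x y clxy; apply: fI; apply: hY => A B nA nB.
have [z [Az Bz]] := clxy _ _ (cf x _ nA) (cf y _ nB).
by exists (f z).
Qed.

Lemma ptws_coord_continuous (I : Type) (Y : topologicalType) (i : I) :
  continuous (fun f : {ptws I -> Y} => f i).
Proof. exact: (@proj_continuous {classic I} (fun=> Y) i). Qed.

Lemma ptws_continuous (X : topologicalType) (I : Type) (Y : topologicalType)
    (f : X -> {ptws I -> Y}) :
  (forall i, continuous (fun x => f x i)) -> continuous f.
Proof.
move=> cf x; apply/cvg_sup => i.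
by apply: (@continuous_comp_initial _ X Y) => // z; exact: cf.
Qed.

Lemma ptws_hausdorff (I : Type) (Y : topologicalType) :
  hausdorff_space Y -> hausdorff_space {ptws I -> Y}.
Proof. by move=> hY; exact: (@hausdorff_product {classic I} (fun=> Y)). Qed.

Lemma ptws_compact (I : Type) (Y : topologicalType) (A : set Y) :
  compact A -> compact [set f : {ptws I -> Y} | forall i, A (f i)].
Proof. by move=> cA; exact: (@tychonoff {classic I} (fun=> Y) (fun=> A)). Qed.

Lemma set_val_continuous (X : topologicalType) (A : set X) :
  continuous (set_val : set_type A -> X).
Proof. exact: initial_continuous. Qed.

Lemma set_type_continuous (X Y : topologicalType) (A : set Y) (f : X -> set_type A) :
  continuous (set_val \o f) -> continuous f.
Proof. exact: continuous_comp_initial. Qed.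

Lemma set_type_compact_space (X : topologicalType) (A : set X) :
  hausdorff_space X -> compact A -> A !=set0 -> compact_space (set_type A).
Proof.
move=> hX cA [a Aa]; split; first exact: set_type_compact.
  by apply: injective_hausdorff hX; [exact: set_val_continuous|exact: val_inj].
by exists (SigSub (mem_set Aa)).
Qed.

(** Members of [G], complemented when they miss [x], intersect in [x] alone; by compactness finitely
    many of them fit into a given neighbourhood. *)
Lemma compact_clopen_based (X : topologicalType) (G : set (set X)) :
  compact [set: X] -> G `<=` clopen -> separates_points G -> clopen_based X.
Proof.
move=> cX Gclopen Gsep; exists clopen => //; split=> [A []//|x A].
rewrite /= nbhsE => -[U [oU Ux] UA].
have oG (g : {g : set X | G g}) : clopen (sval g) by case: g => g /= /Gclopen.
pose F (i : {classic {g : set X | G g}}) := [set y | sval i y <-> sval i x].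
have cF i : clopen (F i).
  have [ix|nix] := pselect (sval i x).
    by rewrite (_ : F i = sval i) //; apply/seteqP; split=> y; rewrite /F/=; tauto.
  rewrite (_ : F i = ~` sval i); first exact: clopenC.
  by apply/seteqP; split=> y; rewrite /F/=; tauto.
have [||s sP] := @compact_finite_sub X _ setT F U cX _ oU.
- by move=> i; case: (cF i).
- move=> y _ Fy; apply: contrapT => nUy; have xy : x <> y by move=> xy; rewrite -xy in nUy.
  by have [g Gg] := Gsep _ _ xy; have := Fy (exist _ g Gg); rewrite /F /=; tauto.
exists [set y | forall i, i \in s -> F i y] => //=; last first.
  by move=> y sy; apply: UA; exact: sP.
split=> //; elim: {sP} s => [|i s IH].
  by rewrite (_ : [set _ | _] = setT); [exact: clopenT|apply/seteqP; split].
rewrite (_ : [set _ | _] = F i `&` [set y | forall j, j \in s -> F j y]); first exact: clopenI.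
apply/seteqP; split=> y /= => [H|[iy sy] j]; last by rewrite inE => /predU1P[->//|/sy].
by split=> [|j js]; apply: H; rewrite inE ?eqxx ?js ?orbT.
Qed.

End Compactness.

(** * Finite patterns under an isomorphism with pseudoclopens *)

Section Isomorphism.
Context {X : Type} {K : topologicalType} {G : set (set X)}.
Context {H : set (set K * set K)} {phi : set X -> set K * set K}.
Hypothesis isoGH : isomorphism G H phi.

(** Adapts the definition of isomorphism to a pattern [psi] on a list: members satisfying [psi] are
    intersected, the others removed. Duplicates are deleted because the definition speaks of
    distinct sets. *)
Lemma isomorphism_split (s : seq (set X)) (psi : set X -> Prop) :
  (forall g, g \in s -> G g) ->
  exists n m (a : 'I_n -> set X) (b : 'I_m -> set X),
    [/\ (forall i, a i \in s /\ psi (a i)), (forall j, b j \in s /\ ~ psi (b j)) &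
        (forall g, g \in s -> (psi g /\ exists i, a i = g) \/ (~ psi g /\ exists j, b j = g))]
    /\
    (((\bigcap_i a i) `\` (\bigcup_j b j) = set0 ->
     (\bigcap_i (phi (a i)).2) `\` (\bigcup_j (phi (b j)).1) = set0) /\
    ((\bigcap_i (phi (a i)).1) `\` (\bigcup_j (phi (b j)).2) = set0 ->
     (\bigcap_i a i) `\` (\bigcup_j b j) = set0)).
Proof.
move=> sG.
pose sa := undup [seq g <- s | `[< psi g >]]; pose sb := undup [seq g <- s | ~~ `[< psi g >]].
have saP g : g \in sa -> g \in s /\ psi g.
  by rewrite mem_undup mem_filter => /andP[/asboolP].
have sbP g : g \in sb -> g \in s /\ ~ psi g.
  by rewrite mem_undup mem_filter => /andP[/asboolPn].
have ua : uniq sa := undup_uniq _; have ub : uniq sb := undup_uniq _.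
pose a i := tnth (in_tuple sa) i; pose b j := tnth (in_tuple sb) j.
have aP i : a i \in s /\ psi (a i) by apply: saP; exact: mem_tnth.
have bP j : b j \in s /\ ~ psi (b j) by apply: sbP; exact: mem_tnth.
have onto (r : seq (set X)) g : g \in r -> exists i, tnth (in_tuple r) i = g.
  by move=> gr; have /tnthP[i ->] : g \in in_tuple r by []; exists i.
exists (size sa), (size sb), a, b; split.
  split=> // g gs; have [pg|npg] := pselect (psi g); [left|right]; split=> //.
    by apply: onto; rewrite mem_undup mem_filter gs andbT; exact/asboolP.
  by apply: onto; rewrite mem_undup mem_filter gs andbT; exact/asboolPn.
apply: isoGH.2.
- by move=> i; apply: sG; case: (aP i).
- by move=> j; apply: sG; case: (bP j).
- by move=> i j; apply/tuple_uniqP.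
- by move=> i j; apply/tuple_uniqP.
- by move=> i j E; case: (bP j) => _; rewrite -E; case: (aP i).
Qed.

(** Contrapositive of the first implication: a pattern that [k] does not contradict is realized in
    [X]. *)
Lemma isomorphism_realize (s : seq (set X)) (psi : set X -> Prop) (k : K) :
  (forall g, g \in s -> G g) ->
  (forall g, g \in s -> (psi g -> (phi g).2 k) /\ (~ psi g -> ~ (phi g).1 k)) ->
  exists x, forall g, g \in s -> g x <-> psi g.
Proof.
move=> sG kP; have [n [m [a [b [[aP bP ab] [iso _]]]]]] := isomorphism_split psi sG.
have /set0P/eqP : (\bigcap_i (phi (a i)).2 `\` \bigcup_j (phi (b j)).1) !=set0.
  exists k; split=> [i _|[j _]]; first by have [? ?] := aP i; apply: (kP _ _).1.
  by have [bs nb] := bP j; apply: (kP _ _).2.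
move=> ne; have /set0P[x [ax bx]] : \bigcap_i a i `\` \bigcup_j b j != set0.
  by apply/eqP => /iso.
exists x => g /ab[[pg [i gE]]|[npg [j gE]]]; split=> // gx.
- by rewrite -gE; exact: ax.
- by case: bx; exists j => //; rewrite gE.
Qed.

(** Contrapositive of the second implication, for the pattern of [x] itself. *)
Lemma isomorphism_lift (s : seq (set X)) (x : X) :
  (forall g, g \in s -> G g) ->
  exists k, forall g, g \in s -> (g x -> (phi g).1 k) /\ (~ g x -> ~ (phi g).2 k).
Proof.
move=> sG; have [n [m [a [b [[aP bP ab] [_ iso]]]]]] := isomorphism_split (fun g => g x) sG.
have /set0P/eqP : (\bigcap_i a i `\` \bigcup_j b j) !=set0.
  by exists x; split=> [i _|[j _]]; [case: (aP i)|case: (bP j)].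
move=> ne; have /set0P[k [ak bk]] :
    \bigcap_i (phi (a i)).1 `\` \bigcup_j (phi (b j)).2 != set0.
  by apply/eqP => /iso.
exists k => g /ab[[pg [i gE]]|[npg [j gE]]]; split=> // _.
  by rewrite -gE; exact: ak.
by move=> gk; apply: bk; exists j => //; rewrite gE.
Qed.

End Isomorphism.

(** * Stationary sets and delta-systems *)

Section Stationary.
Context {d : Order.disp_t} {T : porderType d}.
Hypothesis treeT : is_tree T.
Hypothesis countable_below : forall t : T, countable [set s | (s <= t)%O].
Context {bot : T}.
Hypothesis bot_le : forall t, (bot <= t)%O.

Lemma nonstationary_below (w : T) : nonstationary [set t | (t <= w)%O].
Proof.
apply: (special_nonstationary bot_le).
have /pcard_injP[e eP] := countable_below w; exists e => s t sw tw st est.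
suff E : s = t by rewrite E ltxx in st.
by apply: eP => //; rewrite inE.
Qed.

(** The countably many nodes below each [w] can be discarded. Afterwards every node of [W]
    comparable with [t] is at or below [t], so any branch through [t] is decided on [W]. *)
Lemma stationary_avoid (S : set T) (W : seq T) : ~ nonstationary S ->
  ~ nonstationary (S `&` [set t | forall w, w \in W -> ~ (t < w)%O]).
Proof.
move=> nS; elim: W => [|w W IH].
  by apply: contra_not nS; apply: nonstationary_sub => t St; split.
apply: contra_not (stationaryD IH (nonstationary_below w)); apply: nonstationary_sub.
move=> t [[St tW] ntw]; split=> // v; rewrite inE => /predU1P[->|]; last exact: tW.
by move/ltW.
Qed.

(** Induction on a bound [n] for the number of elements of [F t] outside the current root [r]:
    either overlaps outside [r] are confined to a nonstationary set, or a common element can be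
    moved into the root. *)
Lemma delta_system (I : eqType) (S : set T) (F : T -> seq I) :
  ~ nonstationary S -> exists (S' : set T) (r : seq I),
    [/\ ~ nonstationary S', S' `<=` S & forall s t g, S' s -> S' t -> (s < t)%O ->
      g \in F s -> g \in F t -> g \in r].
Proof.
move=> nS; have [n] := stationary_pigeonhole (fun t => size (F t)) nS.
have {nS} : S `&` [set t | size (F t) = n] `<=`
    S `&` [set t | size [seq g <- F t | g \notin [::]] <= n]%N.
  move=> t [St <-]; split=> //=; apply: leq_trans (size_subseq (filter_subseq _ _)) _.
  exact: leqnn.
move=> sub /(contra_not (nonstationary_sub sub)).
elim: n [::] S {sub} => [|n IH] r S nS.
  exists (S `&` [set t | size [seq g <- F t | g \notin r] <= 0]%N), r.
  split=> // s t g [_ /= s0] _ _ gs _.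
  apply: contraTT s0 => gr; rewrite -ltnNge -has_predT; apply/hasP.
  by exists g => //; rewrite mem_filter gr.
set S0 := S `&` _ in nS.
pose S1 := S0 `&` [set t | exists s g, [/\ S0 s, (s < t)%O, g \in F s, g \in F t & g \notin r]].
have [NS1|nS1] := pselect (nonstationary S1).
  exists (S0 `\` S1), r; split; first exact: stationaryD.
    by move=> t [[]].
  move=> s t g [Ss _] [St nSt] st gs gt.
  by apply: contrapT => /negP gr; apply: nSt; split=> //; exists s, g.
have /choice[f fP] t : exists s, S1 t -> exists g,
    [/\ S0 s, (s < t)%O, g \in F s, g \in F t & g \notin r].
  have [[S0t [s sP]]|nSt] := pselect (S1 t); last by exists t.
  by exists s.
(* Pressing down fixes one earlier node [r0] whose list meets [F t] outside [r]; that list being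
   finite, one shared element serves stationarily many [t]. *)
have [|r0 nS2] := pressing_down treeT countable_below nS1 (f := f).
  by move=> t /fP[g []].
set S2 := S1 `&` _ in nS2.
have [t1 [S1t1 _]] : S2 !=set0.
  apply: contrapT => no; apply: nS2; exists id, (fun=> 0%N).
  by split=> [t|s t] S2t; case: no; eexists; exact: S2t.
have [g1 _] := fP _ S1t1.
have /choice[g gP] t : exists g, S2 t -> [/\ g \in F r0, g \in F t & g \notin r].
  have [[St ft]|nSt] := pselect (S2 t); last by exists g1.
  by have [g [_ _ gs gt gr]] := fP t St; exists g; rewrite /= in ft; rewrite -ft.
have [j nS3] := stationary_pigeonhole (fun t => index (g t) (F r0)) nS2.
have [|S' [r' [nS' S'S S'P]]] := IH (nth g1 (F r0) j :: r) S.
  apply: contra_not nS3; apply: nonstationary_sub => t [S2t /= <-].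
  have [gs gt gr] := gP t S2t; rewrite nth_index //.
  case: S2t => -[[St sz] _] _; split=> //=; rewrite -ltnS; apply: leq_trans _ sz.
  set l := [seq x <- F t | x \notin r].
  have -> : [seq x <- F t | x \notin g t :: r] = [seq x <- l | predC1 (g t) x].
    by rewrite -filter_predI; apply: eq_filter => x; rewrite /= inE negb_or.
  rewrite size_filter -(count_predC (pred1 (g t)) l) -add1n leq_add2r -has_count.
  by apply/hasP; exists (g t); rewrite //= mem_filter gr.
by exists S', r'.
Qed.

End Stationary.

(** * The tree space and its cylinders *)

Section TreeSpace.
Context {d : Order.disp_t} {T : porderType d}.
Hypothesis treeT : is_tree T.

Definition cylinder (t : T) : set (set_type (tree_space T)) :=
  [set x | set_val x t = true].

Lemma tree_spaceP (x : {ptws T -> bool}) :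
  tree_space T x <-> is_chain [set t | x t = true] /\ down_closed [set t | x t = true].
Proof. exact: bar_treeP. Qed.

Lemma clopen_coord (t : T) (b : bool) : clopen [set x : {ptws T -> bool} | x t = b].
Proof.
apply: (@preimage_clopen {ptws T -> bool} bool (fun x => x t) [set b]).
  by split; [exact: discrete_open|exact: discrete_closed].
exact: ptws_coord_continuous.
Qed.

(** By [tree_spaceP] the space is cut out by clopen conditions on pairs of coordinates. *)
Lemma tree_space_closed : closed (tree_space T : set {ptws T -> bool}).
Proof.
rewrite (_ : tree_space T =
  (\bigcap_(p in [set p : T * T | ~~ (p.1 >=< p.2)%O])
     ~` ([set x | x p.1 = true] `&` [set x | x p.2 = true]))
  `&` (\bigcap_(p in [set p : T * T | (p.1 <= p.2)%O])
     ~` ([set x | x p.2 = true] `&` [set x | x p.1 = false]))).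
  by apply: closedI; apply: closed_bigI => p _; apply: open_closedC; apply: openI;
    exact: (clopen_coord _ _).1.
apply/seteqP; split=> x.
  move=> /tree_spaceP[cx dx]; split=> -[s t] /= st [xs xt].
    by case: (cx _ _ xs xt) => H; rewrite /Order.comparable H ?orbT in st.
  by have := dx _ _ st xs; rewrite /= xt.
move=> [cx dx]; apply/tree_spaceP; split=> s t.
  move=> xs xt; apply/orP; apply: contrapT => /negP st.
  exact: (cx (s, t) st).
by move=> st xt /=; case xs : (x s) => //; case: (dx (s, t) st).
Qed.

Lemma branchP (t : T) :
  exists x : set_type (tree_space T), forall u, cylinder u x <-> (u <= t)%O.
Proof.
have tx : tree_space T (fun u => (u <= t)%O : bool).
  apply/tree_spaceP; split=> u v /=; last exact: le_trans.
  by move=> ut vt; apply/orP; exact: (tree_comparable treeT ut vt).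
by exists (SigSub (mem_set tx)).
Qed.

Lemma cylinder_down s t x : (s <= t)%O -> cylinder t x -> cylinder s x.
Proof. by move=> st; have /tree_spaceP[_ dx] := set_valP x; exact: dx st. Qed.

Lemma cylinder_comparable s t x : cylinder s x -> cylinder t x -> (s >=< t)%O.
Proof. by move=> xs xt; have /tree_spaceP[cx _] := set_valP x; exact/orP/cx. Qed.

Lemma cylinder_clopen t : clopen (cylinder t).
Proof.
by apply: (preimage_clopen (clopen_coord t true)); exact: set_val_continuous.
Qed.

Lemma cylinder_ext (x y : set_type (tree_space T)) :
  (forall t, cylinder t x <-> cylinder t y) -> x = y.
Proof.
move=> xy; apply: val_inj; apply: functional_extensionality_dep => t.
by have [xyt yxt] := xy t; apply/idP/idP.
Qed.

Lemma cylinder_separates : separates_points (range cylinder).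
Proof.
move=> x y xy; apply: contrapT => no; apply: xy; apply: cylinder_ext => t.
have xyt : ~ (cylinder t x /\ ~ cylinder t y \/ ~ cylinder t x /\ cylinder t y).
  by move=> xyt; apply: no; exists (cylinder t); [exists t|].
by split=> ?; apply: contrapT => ?; apply: xyt; [left|right].
Qed.

Lemma tree_space_compact (t : T) : compact_space (set_type (tree_space T)).
Proof.
have [x _] := branchP t.
apply: set_type_compact_space; last by exists (set_val x); exact: set_valP.
  exact: ptws_hausdorff discrete_hausdorff.
by apply: subclosed_compact tree_space_closed (ptws_compact bool_compact) _.
Qed.

Lemma tree_space_clopen_based (t : T) : clopen_based (set_type (tree_space T)).
Proof.
have [cL _ _] := tree_space_compact t.
apply: (compact_clopen_based cL) cylinder_separates.
by move=> _ [s _ <-]; exact: cylinder_clopen.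
Qed.

End TreeSpace.

(** * Stationary families of sets drawn from a Boolean image *)

(** Compactness of the square: pairs on which all [F i] agree are diagonal, hence lie in the clopen
    set of pairs on which [a] agrees. *)
Lemma clopen_determined (X : topologicalType) (I : eqType) (F : I -> set X) (a : set X) :
  compact [set: X] -> (forall i, clopen (F i)) -> separates_points (range F) -> clopen a ->
  exists s : seq I, forall x y, (forall i, i \in s -> F i x <-> F i y) -> (a x <-> a y).
Proof.
move=> cX cF sepF ca.
pose agree (b : set X) := [set p : X * X | b p.1 <-> b p.2].
have agree_clopen b : clopen b -> clopen (agree b).
  move=> cb; rewrite (_ : agree b = (fst @^-1` b `&` snd @^-1` b) `|`
    (fst @^-1` (~` b) `&` snd @^-1` (~` b))).
    have cnb := clopenC b cb.
    by apply: clopenU; apply: clopenI; apply: preimage_clopen => // p;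
      [exact: cvg_fst|exact: cvg_snd|exact: cvg_fst|exact: cvg_snd].
  apply/seteqP; split=> -[x y]; rewrite /agree/=; last tauto.
  by have [bx|nbx] := pselect (b x); tauto.
have [||||s sP] := @compact_finite_sub (X * X)%type I setT (fun i => agree (F i)) (agree a).
- by rewrite -setXTT; exact: compact_setX.
- by move=> i; case: (agree_clopen _ (cF i)).
- by case: (agree_clopen _ ca).
- move=> [x y] _ /= xy; suff -> : x = y by [].
  apply: contrapT => /sepF[_ [i _ <-]]; have := xy i; rewrite /agree/=; tauto.
by exists s => x y xy; exact: (sP (x, y)).
Qed.

(** [O] and [E] ask for the common root pattern, weakly and strictly. [P t] asks for a branch
    through [t] compatible with the point on [F t]; [N t] asks that every pattern compatible with it
    off the root be shown by a branch through [t]. *)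
Lemma boolean_image_chain {d : Order.disp_t} (T : porderType d) (bot : T)
    (K : topologicalType) :
  is_tree T -> (forall t : T, countable [set s | (s <= t)%O]) ->
  (forall t, (bot <= t)%O) -> ~ special [set: T] ->
  compact [set: K] -> boolean_image (set_type (tree_space T)) K ->
  exists (S : set T) (O E : set K) (P N : T -> set K) (k : T -> K),
    [/\ ~ nonstationary S, open O, closed E & E `<=` O] /\
    [/\ forall t, S t -> [/\ open (P t), closed (N t), O `&` N t `<=` P t, E (k t) & N t (k t)],
        forall s t, S s -> S t -> (s < t)%O -> P t `<=` N s &
        forall s t, S s -> S t -> ~ (t <= s)%O -> ~ N t (k s)].
Proof.
move=> treeT countT botle nspecial cK [G [Gclopen Gsep [H [phi [Hpc iso]]]]].
set L := set_type (tree_space T) in G Gclopen Gsep phi iso *.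
have [cL _ _] := tree_space_compact treeT bot.
have pcP g : G g -> pseudoclopen (phi g).
  by move=> Gg; apply: Hpc; have [[+ _ _] _] := iso; apply.
pose I : eqType := set_type G.
pose g_ (i : I) : set L := set_val i.
have Gi i : G (g_ i) by exact: set_valP.
have sub_incl i : (phi (g_ i)).1 `<=` (phi (g_ i)).2 by case: (pcP _ (Gi i)).
have determined a : clopen a -> exists s : seq I,
    forall x y, (forall i, i \in s -> g_ i x <-> g_ i y) -> (a x <-> a y).
  apply: clopen_determined => // [i|x y xy]; first exact: Gclopen.
  by have [a' Ga' axy] := Gsep _ _ xy; exists a' => //; exists (SigSub (mem_set Ga')).
have /choice[F FP] t := determined _ (@cylinder_clopen _ T t).
have /choice[br brP] := branchP treeT.
have /choice[W WP] (i : I) : exists s : seq T, forall x y : L,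
    (forall t, t \in s -> cylinder t x <-> cylinder t y) -> (g_ i x <-> g_ i y).
  apply: clopen_determined => //; [exact: cylinder_clopen|exact: cylinder_separates|exact: Gclopen].
have nS0 : ~ nonstationary [set: T].
  by apply: contra_not nspecial; exact: nonstationary_setT.
have [S1 [r [nS1 _ delta]]] := delta_system treeT countT F nS0.
(* These nodes decide the members of [G] indexed by the root. *)
pose w := flatten [seq W i | i <- r].
have wP (x y : L) : (forall t, t \in w -> cylinder t x <-> cylinder t y) ->
    forall i, i \in r -> g_ i x <-> g_ i y.
  move=> xy i ir; apply: WP => t ti; apply: xy; apply/flatten_mapP.
  by exists i.
have nS2 := stationary_avoid countT botle (W := w) nS1.
(* All nodes of [S] lie above the same nodes of [w]; hence all branches through nodes of [S] show
   one pattern on [r]. *)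
have [pat nS3] := stationary_pigeonhole (fun t => [seq (v <= t)%O | v <- w]) nS2.
set S := _ `&` [set t | _ = pat] in nS3.
have S_decides t x : S t -> cylinder t x -> forall i, i \in r -> g_ i x <-> g_ i (br t).
  move=> [[_ tw] _] xt; apply: wP => v vw; rewrite brP; split=> [xv|vt]; last first.
    exact: (cylinder_down treeT vt xt).
  have /orP[//|] := cylinder_comparable treeT xv xt.
  by rewrite le_eqVlt => /predU1P[->//|/(tw _ vw)].
have S_pattern s t : S s -> S t -> forall i, i \in r -> g_ i (br s) <-> g_ i (br t).
  move=> [_ /= sp] [_ /= tp]; apply: wP => v vw; rewrite !brP.
  suff -> : (v <= s)%O = (v <= t)%O by [].
  by move: sp; rewrite -tp => /eq_in_map; exact.
(* [strict]: [k] answers as [x] does. [compat]: [k] does not contradict [x], both answers being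
   allowed between the closed and the open part. *)
pose strict (x : L) (k : K) (i : I) :=
  (g_ i x -> (phi (g_ i)).1 k) /\ (~ g_ i x -> ~ (phi (g_ i)).2 k).
pose compat (s : seq I) (k : K) (x : L) := forall i, i \in s ->
  ((phi (g_ i)).1 k -> g_ i x) /\ (g_ i x -> (phi (g_ i)).2 k).
have strict_closed x i : closed [set k | strict x k i].
  have [c1 o2 _] := pcP _ (Gi i); have [ix|nix] := pselect (g_ i x).
    rewrite (_ : [set _ | _] = (phi (g_ i)).1) //.
    by apply/seteqP; split=> k; rewrite /strict/=; tauto.
  rewrite (_ : [set _ | _] = ~` (phi (g_ i)).2); first exact: open_closedC.
  by apply/seteqP; split=> k; rewrite /strict/=; tauto.
have compat_open s x : open [set k | compat s k x].
  elim: s => [|i s IH].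
    by rewrite (_ : [set _ | _] = setT); [exact: openT|apply/seteqP; split].
  have oi : open [set k | ((phi (g_ i)).1 k -> g_ i x) /\ (g_ i x -> (phi (g_ i)).2 k)].
    have [c1 o2 _] := pcP _ (Gi i); have [ix|nix] := pselect (g_ i x).
      by rewrite (_ : [set _ | _] = (phi (g_ i)).2) //; apply/seteqP; split=> k /=; tauto.
    rewrite (_ : [set _ | _] = ~` (phi (g_ i)).1); first exact: closed_openC.
    by apply/seteqP; split=> k /=; tauto.
  rewrite (_ : [set _ | _] = [set k | ((phi (g_ i)).1 k -> g_ i x) /\
    (g_ i x -> (phi (g_ i)).2 k)] `&` [set k | compat s k x]); first exact: openI.
  apply/seteqP; split=> k /= => [ck|[ik ck] j]; last by rewrite inE => /predU1P[->//|/ck].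
  by split=> [|j js]; apply: ck; rewrite inE ?eqxx ?js ?orbT.
have realize (s : seq I) (k : K) (psi : I -> Prop) :
    (forall i, i \in s -> (psi i -> (phi (g_ i)).2 k) /\ (~ psi i -> ~ (phi (g_ i)).1 k)) ->
    exists x, forall i, i \in s -> g_ i x <-> psi i.
  move=> kP.
  have [||x xP] := isomorphism_realize iso (s := map g_ s)
      (psi := fun g => exists i, g = g_ i /\ psi i) (k := k).
  - by move=> _ /mapP[i _ ->].
  - move=> _ /mapP[i si ->]; split=> [[j [ij pj]]|np]; last first.
      by apply: (kP i si).2 => pi; apply: np; exists i.
    by apply: (kP i si).1; rewrite (val_inj ij).
  exists x => i si; apply: iff_trans (xP _ (map_f g_ si)) _.
  by split=> [[j [ij pj]]|pi]; [rewrite (val_inj ij)|exists i].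
(* Answering by the open part never contradicts [k], since the closed part lies inside it. *)
have compat_ex s k : exists x, compat s k x.
  have [|x xP] := realize s k (fun i => (phi (g_ i)).2 k).
    by move=> i _; split=> // n2 /sub_incl.
  by exists x => i si; have := xP i si; have := @sub_incl i k; tauto.
(* Finitely many strict conditions are met by [isomorphism_lift], all of them by compactness of
   [K]. *)
have /choice[k kP] t : exists k, forall i, strict (br t) k i.
  apply: contrapT => no.
  have [|||s sP] := @compact_finite_sub K I setT (fun i => [set k | strict (br t) k i]) set0 cK.
  - by move=> i; exact: strict_closed.
  - exact: open0.
  - by move=> k _ kt; apply: no; exists k.
  have [|k0 k0P] := isomorphism_lift iso (s := map g_ s) (br t).
    by move=> _ /mapP[i _ ->].
  by apply: (sP k0) => // i si; apply: k0P; exact: map_f.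
have [t1 St1] : S !=set0.
  apply: contrapT => no; apply: nS3; exists id, (fun=> 0%N).
  by split=> [t|s t] St; case: no; eexists; exact: St.
pose D t := [seq i <- F t | i \notin r].
pose O := [set k | compat r k (br t1)].
pose E := [set k | forall i, i \in r -> strict (br t1) k i].
pose P t := [set k | exists x, cylinder t x /\ compat (F t) k x].
pose N t := [set k | forall x, compat (D t) k x ->
  exists y, cylinder t y /\ forall i, i \in D t -> g_ i y <-> g_ i x].
exists S, O, E, P, N, k; split; split=> //.
- exact: compat_open.
- rewrite (_ : E = \bigcap_(i in [set` r]) [set k | strict (br t1) k i]) //.
  by apply: closed_bigI => i _; exact: strict_closed.
- move=> k0 Ek0 i ir; have [] := Ek0 i ir; have := @sub_incl i k0.
  by have [ix|nix] := pselect (g_ i (br t1)); tauto.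
- move=> t St; split.
  + rewrite (_ : P t = \bigcup_(x in cylinder t) [set k | compat (F t) k x]).
      by apply: bigcup_open => x _; exact: compat_open.
    by apply/seteqP; split=> k0 [x]; [move=> [xt kx]|move=> xt kx]; exists x.
  + rewrite (_ : N t = ~` \bigcup_(x in [set x | ~ exists y, cylinder t y /\
        forall i, i \in D t -> g_ i y <-> g_ i x]) [set k | compat (D t) k x]).
      by apply: open_closedC; apply: bigcup_open => x _; exact: compat_open.
    apply/seteqP; split=> k0 /= Nk0 => [[x /= nx kx]|x kx]; first by apply: nx; exact: Nk0.
    by apply: contrapT => nx; apply: Nk0; exists x.
  + move=> k0 [Ok0 Nk0]; have [x kx] := compat_ex (D t) k0.
    have [y [yt yx]] := Nk0 x kx; exists y; split=> // i it.
    have [ir|nir] := boolP (i \in r).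
      have := S_decides t y St yt i ir; have := S_pattern t t1 St St1 i ir.
      have := Ok0 i ir; tauto.
    have iD : i \in D t by rewrite mem_filter nir.
    have := yx i iD; have := kx i iD; tauto.
  + by move=> i ir; have := kP t i; have := S_pattern t t1 St St1 i ir; rewrite /strict; tauto.
  + move=> x kx; exists (br t); split; first exact/brP.
    move=> i iD; have := kP t i; have := kx i iD; rewrite /strict.
    by have [ix|nix] := pselect (g_ i (br t)); tauto.
- move=> s t Ss St st k0 [x [xt kx]] x' kx'.
  (* [D s] is disjoint from [F t], so one [y] can copy [x] on [F t] and [x'] on [D s]; it passes
     through [t], hence through [s]. *)
  have [|y yP] := realize (F t ++ D s) k0 (fun i => if i \in F t then g_ i x else g_ i x').
    move=> i; rewrite mem_cat; have [it _|_ /= iD] := boolP (i \in F t).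
      by have := kx i it; tauto.
    by have := kx' i iD; tauto.
  exists y; split.
    apply: (cylinder_down treeT (ltW st)); apply/(FP t y x) => // i it.
    by have := yP i; rewrite mem_cat it /=; apply.
  move=> i iD; have := yP i; rewrite mem_cat iD orbT ifN; first exact.
  move: iD; rewrite mem_filter => /andP[nir Fs]; apply: contra nir => Ft.
  by have [[S1s _] _] := Ss; have [[S1t _] _] := St; exact: (delta s t i).
(* [br s] is compatible with [k s], so [N t (k s)] makes it agree off the root with a branch through
   [t]; on the root they agree anyway, so [br s] passes through [t]. *)
- move=> s t Ss St ts Nts; apply: ts; apply/brP.
  have [|y [yt yP]] := Nts (br s).
    move=> i _; have := kP s i; have := @sub_incl i (k s); rewrite /strict.
    by have [ix|nix] := pselect (g_ i (br s)); tauto.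
  apply/(FP t _ y) => // i it; have [ir|nir] := boolP (i \in r).
    have := S_decides t y St yt i ir; have := S_pattern t s St Ss i ir; tauto.
  by have := yP i; rewrite mem_filter nir it => /(_ isT); tauto.
Qed.

(** * Segments and small convex neighbourhoods in a product of lines *)

Section Segments.
Context {R : realType} {Gamma : Type}.
Notation V := {ptws Gamma -> R}.

Definition segment_point (p k : V) (q : R) : V := fun i => q * k i + (1 - q) * p i.

(** Convexity spelled out pointwise, as the convex structure is on [Gamma -> R^o] and the topology
    on [{ptws Gamma -> R}]. *)
Definition segment_closed (B : set V) := forall x y q,
  B x -> B y -> 0 <= q <= 1 -> B (segment_point x y q).

Lemma convex_segment_closed (C : set V) :
  @convex_set R (Gamma -> R^o) C -> segment_closed C.
Proof.
move=> cC x y q Cx Cy /andP[q0 q1].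
have := cC y x (Itv01 q0 q1) (mem_set Cy) (mem_set Cx).
by rewrite inE.
Qed.

Lemma norm_segment (x y z b q : R) : `|x - z| <= b -> `|y - z| <= b -> 0 <= q <= 1 ->
  `|q * y + (1 - q) * x - z| <= b.
Proof.
move=> xz yz /andP[q0 q1]; rewrite (_ : _ - z = q * (y - z) + (1 - q) * (x - z)); last by ring.
rewrite (_ : b = q * b + (1 - q) * b); last by ring.
have q1' : 0 <= 1 - q by rewrite subr_ge0.
apply: le_trans (ler_normD _ _) _; rewrite !normrM (ger0_norm q0) (ger0_norm q1').
by apply: lerD; exact: ler_wpM2l.
Qed.

Lemma segment_point_continuous (p : V) :
  continuous (fun z : R * V => segment_point p z.2 z.1).
Proof.
apply: ptws_continuous => i z; rewrite /segment_point.
have ck : {for z, continuous (fun z : R * V => z.2 i)}.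
  apply: (@continuous_comp _ _ _ snd (fun f : V => f i)); first exact: cvg_snd.
  exact: ptws_coord_continuous.
have cq : {for z, continuous (fun z : R * V => z.1)} by exact: cvg_fst.
apply: (@cvgD R R _ (nbhs z) _ (fun z => z.1 * z.2 i) (fun z => (1 - z.1) * p i)).
  exact: (@cvgM R _ (nbhs z) _ (fun z => z.1) (fun z => z.2 i)).
apply: (@cvgM R _ (nbhs z) _ (fun z => 1 - z.1) (fun=> p i)); last exact: cvg_cst.
by apply: (@cvgB R R _ (nbhs z) _ (fun=> 1) (fun z => z.1)) => //; exact: cvg_cst.
Qed.

(** By compactness there is a least ratio [q0] at which the contracted [B] meets [N]; it is positive
    as [p] is outside [N]. The meeting point lies in [P], which is open, so a slightly smaller
    rational ratio still meets [P] and misses [N] by minimality. *)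
Lemma segment_crossing (B N P : set V) (p : V) :
  compact B -> segment_closed B -> B p -> ~ N p -> B `&` N !=set0 ->
  closed N -> open P -> B `&` N `<=` P ->
  exists q : rat, [/\ 0 <= (ratr q : R) <= 1,
    exists k, B k /\ P (segment_point p k (ratr q)) &
    ~ exists k, B k /\ N (segment_point p k (ratr q))].
Proof.
move=> cB sB Bp nNp [k1 [Bk1 Nk1]] cN oP BNP.
have cseg := @segment_point_continuous p.
pose M : set (R * V) := (`[0, 1] `*` B) `&` [set z | N (segment_point p z.2 z.1)].
have cM : compact M.
  apply: compact_closedI; first by apply: compact_setX => //; exact: segment_compact.
  by move/continuous_closedP : cseg; exact.
have seg1 k : segment_point p k 1 = k.
  by apply: functional_extensionality_dep => i; rewrite /segment_point; ring.
have seg0 k : segment_point p k 0 = p.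
  by apply: functional_extensionality_dep => i; rewrite /segment_point; ring.
have [||[q0 k0]] := compact_EVT_min (f := fst) _ cM.
- exists (1, k1); split=> /=; last by rewrite seg1.
  by split=> //=; rewrite in_itv /= ler01 lexx.
- by apply: continuous_subspaceT => z; exact: cvg_fst.
rewrite inE => -[[/= q01 Bk0] /= Nk0] minq.
rewrite in_itv /= in q01.
have q0_gt0 : 0 < q0.
  by rewrite lt_def (andP q01).1 andbT; apply/eqP => q00; move: Nk0; rewrite q00 seg0.
have : nbhs q0 [set q | P (segment_point p k0 q)].
  have cq : continuous (fun q : R => segment_point p k0 q).
    move=> q; apply: (@continuous_comp R (R * V)%type V (fun q => (q, k0))
      (fun z => segment_point p z.2 z.1)); last exact: cseg.
    exact: (@cvg_pair R R V (nbhs q) (nbhs q) (nbhs k0) _ _ _ id (fun=> k0) cvg_id (cvg_cst k0)).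
  have Pq0 : P (segment_point p k0 q0) by apply: BNP; split=> //; exact: sB.
  exact: (cq q0 P (open_nbhs_nbhs (conj oP Pq0))).
move=> /nbhs_ballP[e /= e0 eP].
have [|q] := @rat_in_itvoo R (Num.max 0 (q0 - e)) q0.
  by rewrite gt_max q0_gt0 /=; lra.
rewrite in_itv /= gt_max => /andP[/andP[q_gt0 qe] qq0].
have /andP[q00 q01'] := q01; exists q; split=> [||[k [Bk Nk]]].
- by apply/andP; split; lra.
- exists k0; split=> //; apply: eP; rewrite /ball /= ltr_norml; lra.
suff : q0 <= ratr q by rewrite leNgt qq0.
apply: (minq (ratr q, k)); rewrite inE; split=> //=; split=> //=.
rewrite in_itv /=; lra.
Qed.

Lemma segment_closedI (B B' : set V) :
  segment_closed B -> segment_closed B' -> segment_closed (B `&` B').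
Proof.
by move=> sB sB' x y q [Bx B'x] [By B'y] q01; split; [exact: sB|exact: sB'].
Qed.

Lemma coord_dist_continuous (i : Gamma) (a : R) : continuous (fun x : V => `|x i - a|).
Proof.
move=> x; apply: (@continuous_comp V R R (fun x => x i) (fun r => `|r - a|)).
  exact: ptws_coord_continuous.
apply: (@continuous_comp R R R (fun r => r - a) (fun r => `|r|)); last exact: norm_continuous.
by apply: (@continuousB R R R id (cst a)); [exact: cvg_id|exact: cvg_cst].
Qed.

(** The closed slabs [F i] around [e] are convex and intersect in [e], so finitely many of them
    bring [C] inside [U]. The open slabs of the same widths give [W]. *)
Lemma convex_nbhs (C : set V) (e : V) (U : set V) :
  compact C -> segment_closed C -> C e -> open U -> U e ->
  exists B : set V, [/\ compact B, segment_closed B, B `<=` C `&` U &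
    exists2 W, open W /\ W e & C `&` W `<=` B].
Proof.
move=> cC sC Ce oU Ue.
pose F (i : {classic Gamma} * nat) : set V := [set x | `|x i.1 - e i.1| <= i.2.+1%:R^-1].
have cF i : closed (F i).
  apply: (@closed_comp V R (fun x : V => `|x i.1 - e i.1|) [set r | r <= i.2.+1%:R^-1]);
    last exact: closed_le.
  by move=> x _; exact: coord_dist_continuous.
have sF i : segment_closed (F i).
  move=> x y q; rewrite /F /segment_point /=; move: (x _) (y _) (e _) (_^-1).
  move=> {x y} x y z b xz yz q01; exact: norm_segment.
have [x _ xF|s sP] := compact_finite_sub cC cF oU.
  suff -> : x = e by [].
  apply: functional_extensionality_dep => i; apply/eqP; rewrite -subr_eq0 -normr_le0.
  apply/ler_addgt0Pl => eps eps0; rewrite addr0.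
  have [n ne] := ltr_add_invr (y := 0) (x := eps) eps0.
  by apply: le_trans (xF (i, n)) _; rewrite add0r in ne; exact: ltW.
exists (C `&` [set x | forall i, i \in s -> F i x]); split.
- apply: compact_closedI => //.
  rewrite (_ : [set x | _] = \bigcap_(i in [set` s]) F i) //.
  by apply: closed_bigI => i _.
- apply: segment_closedI => // x y q xs ys q01 i si.
  by apply: sF => //; [exact: xs|exact: ys].
- by move=> x [Cx xs]; split=> //; exact: sP.
exists [set x | forall i, i \in s -> `|x i.1 - e i.1| < i.2.+1%:R^-1]; last first.
  by move=> x [Cx xW]; split=> // i /xW /ltW.
split=> [|i _]; last by rewrite subrr normr0 invr_gt0.
elim: {sP} s => [|i s IH].
  by rewrite (_ : [set _ | _] = setT); [exact: openT|apply/seteqP; split].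
rewrite (_ : [set _ | _] = [set x : V | `|x i.1 - e i.1| < i.2.+1%:R^-1] `&`
    [set x | forall i, i \in s -> `|x i.1 - e i.1| < i.2.+1%:R^-1]).
  apply: openI => //.
  apply: (@open_comp V R (fun x : V => `|x i.1 - e i.1|) [set r | r < i.2.+1%:R^-1]);
    last exact: open_lt.
  by move=> x _; exact: coord_dist_continuous.
apply/seteqP; split=> x /= => [H|[ix sx] j]; last by rewrite inE => /predU1P[->//|/sx].
by split=> [|j js]; apply: H; rewrite inE ?eqxx ?js ?orbT.
Qed.

End Segments.

(** * Compact convex sets and contraction ratios *)

Lemma convex_not_boolean_image {d : Order.disp_t} (T : porderType d) (bot : T)
    (R : realType) (Gamma : Type) (C : set {ptws Gamma -> R}) :
  is_tree T -> (forall t : T, countable [set s | (s <= t)%O]) ->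
  (forall t, (bot <= t)%O) -> ~ special [set: T] ->
  compact C -> @convex_set R (Gamma -> R^o) C ->
  ~ boolean_image (set_type (tree_space T)) (set_type C).
Proof.
move=> treeT countT botle nspecial cC convC bi.
have cK := set_type_compact cC.
have [S [Q [E [P [N [k [[nS oQ cE EQ] [tP chain upper]]]]]]]] :=
  boolean_image_chain treeT countT botle nspecial cK bi.
(* The filter dual to the ideal, carried over by [k]: each neighbourhood of a cluster point contains
   [k t] for stationarily many [t]. *)
pose Phi : set_system (set_type C) :=
  [set A | nonstationary (S `&` [set t | ~ A (k t)])].
have PhiF : ProperFilter Phi.
  split=> [|]; first by apply: contra_not nS; apply: nonstationary_sub => t St; split.
  split=> [|A B NA NB|A B AB].
  - by exists id, (fun=> 0%N); split=> [t|s t] [_ []].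
  - apply: nonstationary_sub (nonstationaryU NA NB) => t [St nAB].
    have [At|nAt] := pselect (A (k t)); [right|left]; split=> // Bt.
    exact: nAB.
  - by apply: nonstationary_sub => t [St nB]; split=> // /AB.
have [|e [_ cle]] := cK Phi PhiF; first exact: filterT.
have Ee : E e.
  apply: cE => A nA; apply: cle nA.
  exists id, (fun=> 0%N); split=> [t|s t] [St nE]; case: nE; by case: (tP _ St).
have [U oU UQ] : exists2 U, open U & set_val @^-1` U = Q by case: oQ => U oU; exists U.
have [|B [cB sB BCU [W [oW We] WB]]] :=
    convex_nbhs cC (convex_segment_closed convC) (set_valP e) oU.
  by have := EQ _ Ee; rewrite -UQ.
pose SB := S `&` [set t | B (set_val (k t))].
have nSB : ~ nonstationary SB.
  move=> NSB; have [||x [nBx Bx]] := cle (~` (set_val @^-1` B)) (set_val @^-1` B).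
  - by apply: nonstationary_sub NSB => t [St] /= /contrapT.
  - apply: (@filterS _ _ _ (set_val @^-1` W)).
      by move=> x Wx; apply: WB; split=> //; exact: set_valP.
    by apply: set_val_continuous; exact: open_nbhs_nbhs.
  exact: nBx.
have [t0 [St0 Bt0]] : SB !=set0.
  apply: contrapT => no; apply: nSB; exists id, (fun=> 0%N).
  by split=> [t|s t] St; case: no; eexists; exact: St.
(* Without the nodes up to [t0], the point [k t0] lies outside every remaining [N t]. The remaining
   nodes will turn out to be special. *)
have := stationaryD nSB (nonstationary_below countT botle t0); apply.
apply: (special_nonstationary botle).
(* [P'] and [N'] extend the sets from [C] to the ambient product, where segments are formed. *)
have /choice[P' P'P] t : exists P' : set {ptws Gamma -> R},
    S t -> open P' /\ set_val @^-1` P' = P t.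
  have [St|nSt] := pselect (S t); last by exists set0.
  by have [[P' oP' P'E] _ _ _ _] := tP t St; exists P'.
have /choice[N' N'P] t : exists N' : set {ptws Gamma -> R},
    S t -> closed N' /\ set_val @^-1` N' = N t.
  have [St|nSt] := pselect (S t); last by exists set0.
  have [_ /closed_openC[N' oN' N'E] _ _ _] := tP t St; exists (~` N') => _.
  split; first exact: open_closedC.
  by rewrite -[RHS]setCK -N'E preimage_setC.
pose p := set_val (k t0); pose SC := SB `\` [set t | (t <= t0)%O].
have liftC x : C x -> exists y : set_type C, set_val y = x.
  by move=> Cx; exists (SigSub (mem_set Cx)).
have /choice[c cP] t : exists q : rat, SC t ->
    [/\ 0 <= (ratr q : R) <= 1,
    exists x, B x /\ P' t (segment_point p x (ratr q)) &
    ~ exists x, B x /\ N' t (segment_point p x (ratr q))].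
  have [[[St Bt] tt0]|nSt] := pselect (SC t); last by exists 0.
  have [_ _ QNP _ Nt] := tP t St; have [oP' P'E] := P'P t St; have [cN' N'E] := N'P t St.
  have [|||q qP] := @segment_crossing R Gamma B (N' t) (P' t) p cB sB Bt0 _ _ cN' oP'.
  - by move=> Np; apply: (upper t0 t St0 St tt0); rewrite -N'E.
  - by exists (set_val (k t)); split=> //; rewrite -N'E in Nt.
  - move=> x [Bx Nx]; have [Cx Ux] := BCU _ Bx; have [y yx] := liftC _ Cx.
    by move: Nx Ux; rewrite -yx => Ny Uy; have := QNP y; rewrite -P'E -UQ -N'E; apply.
  by exists q.
(* The ratio is the colour: if [s < t] shared it, the contracted box would meet [P t], hence [N s],
   against the choice for [s]. *)
exists (pickle \o c) => s t Cs Ct st /(pcan_inj pickleK) cst.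
have [_ _] := cP s Cs; have [q01 [x [Bx Px]] _] := cP t Ct; apply.
exists x; split=> //; rewrite cst.
have [[Ss _] _] := Cs; have [[St _] _] := Ct.
have [Cz _] := BCU _ (sB _ _ _ Bt0 Bx q01); have [y yz] := liftC _ Cz.
have Py : P t y by rewrite -(P'P t St).2 /= yz.
by have := chain s t Ss St st y Py; rewrite -(N'P s Ss).2 /= yz.
Qed.

(** * The compact space of soft branches *)

Section SoftBranches.
Context {R : realType} {d : Order.disp_t} {T : porderType d}.
Hypothesis treeT : is_tree T.

(* Branches of [T] whose last node may carry a weight in ]0, 1[. *)
Definition soft_branch : set {ptws T -> R} :=
  [set f | [/\ forall t, 0 <= f t <= 1, forall s t, (s < t)%O -> 0 < f t -> f s = 1 &
               forall s t, 0 < f s -> 0 < f t -> (s >=< t)%O]].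

(** Given weights in [0, 1], the conditions on positive weights become alternatives between
    equations [f t = 0] or [f s = 1], which are closed. *)
Lemma soft_branch_compact : compact soft_branch.
Proof.
have coord_cont t : continuous (fun f : {ptws T -> R} => f t) by exact: ptws_coord_continuous.
pose box := [set f : {ptws T -> R} | forall t, `[0, 1]%classic (f t)].
pose down := \bigcap_(p in [set p : T * T | (p.1 < p.2)%O])
  ([set f : {ptws T -> R} | f p.2 = 0] `|` [set f : {ptws T -> R} | f p.1 = 1]).
pose chain := \bigcap_(p in [set p : T * T | ~~ (p.1 >=< p.2)%O])
  ([set f : {ptws T -> R} | f p.1 = 0] `|` [set f : {ptws T -> R} | f p.2 = 0]).
have -> : soft_branch = box `&` (down `&` chain).
  apply/seteqP; split=> f.
    move=> [f01 fd fc]; split=> [t|]; first by rewrite /= in_itv /=.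
    have f0 t : f t = 0 \/ 0 < f t.
      by have /andP[+ _] := f01 t; rewrite le_eqVlt => /predU1P[<-|]; [left|right].
    split=> -[s t] /= st; last first.
      have [fs|fs] := f0 s; [by left|have [ft|ft] := f0 t; [by right|]].
      by rewrite fc in st.
    by have [ft|ft] := f0 t; [left|right; exact: fd st ft].
  move=> [f01 [fd fc]]; split=> [t|s t st ft|s t fs ft].
  - by have := f01 t; rewrite /= in_itv.
  - by have [/= ft0|//] := fd (s, t) st; rewrite ft0 ltxx in ft.
  - apply: contrapT => /negP st; have [/= f0|/= f0] := fc (s, t) st.
      by rewrite f0 ltxx in fs.
    by rewrite f0 ltxx in ft.
have coord_closed t (a : R) : closed [set f : {ptws T -> R} | f t = a].
  by apply: (@closed_comp _ R (fun f : {ptws T -> R} => f t) [set a]) => [f _|];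
    [exact: coord_cont|exact: closed_eq].
apply: compact_closedI; first exact: ptws_compact (segment_compact (a := 0) (b := 1)).
by apply: closedI; apply: closed_bigI => -[s t] _ /=; apply: closedU.
Qed.

End SoftBranches.

(** * Ramps that schedule the contraction of a soft branch *)

Section Ramps.
Context {R : realType}.

(** [contract] sends reals into ]-1, 1[, rescaled here to ]0, 1/2[; the upper half of [0, 1] is kept
    for [u] itself. *)
Lemma rat_embedding : exists g : rat -> R,
  (forall q, 0 < g q < 2^-1) /\ (forall p q, p < q -> g p < g q).
Proof.
exists (fun q => (contract (ratr q)%:E + 1) / 4); split=> [q|p q pq].
  by have := contract_lt1 (ratr q : R); rewrite ltr_norml; lra.
have := lt_contract (ratr p : R)%:E (ratr q)%:E; rewrite lte_fin ltr_rat pq; lra.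
Qed.

(* The interval of [t] starts at the image of the least element of [u] outside [t]. *)
Lemma wo_rat_intervals (u : wo_rat) : exists l r : wo_rat -> R,
  (forall t, [/\ 0 <= l t, l t < r t & r t <= 1]) /\
  (forall s t, (s < t)%O -> (t <= u)%O -> r s <= l t).
Proof.
have [g [g01 gmono]] := rat_embedding.
pose gap (t : wo_rat) (q : rat) := [/\ elements u q, ~ elements t q &
  forall x, elements u x -> (elements t x <-> x < q)].
(* The interval of [t] ends at the image of the next element of [u], or at 1/2 if there is none. *)
have /choice[p pP] t : exists p : R * R, [/\ 0 <= p.1, p.1 < p.2 & p.2 <= 1] /\
    (if (t < u)%O then exists q, [/\ gap t q, p.1 = g q, p.2 <= 2^-1 &
       forall q', elements u q' -> q < q' -> p.2 <= g q'] else p.1 = 2^-1).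
  have [tu|_] := boolP (t < u)%O; last by exists (2^-1, 1); split=> //; split=> /=; lra.
  have [q qP] := wo_rat_gap tu; have gq := g01 q.
  have [[q' [uq' qq']]|no] := pselect (exists q', elements u q' /\ q < q').
    have [|m [[um qm] minm]] :=
      @wo_rat_ex_min u (elements u `&` [set x | q < x]) q' _ (conj uq' qq').
      by move=> x [].
    have gm := g01 m; have gqm := gmono _ _ qm.
    exists (g q, g m); split; first by split=> /=; lra.
    exists q; split=> //=; first by lra.
    move=> x ux qx; have : m <= x by exact: minm.
    by rewrite le_eqVlt => /predU1P[->//|/gmono /ltW].
  exists (g q, 2^-1); split; first by split=> /=; lra.
  by exists q; split=> //= x ux qx; case: no; exists x.
exists (fun t => (p t).1), (fun t => (p t).2); split=> [t|s t st tu]; first by case: (pP t).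
have [_] := pP s; rewrite (lt_le_trans st tu) => -[q [[uq nsq qs] _ s2 next]].
have [_] := pP t; have [tu'|_] := boolP (t < u)%O; last by move=> ->.
move=> [q' [[uq' ntq' qt] -> _ _]]; apply: next => //.
apply/(qt _ uq); have [x [tx nsx _]] := wo_rat_gap st.
have /wo_rat_leP[tu_ itu] := tu.
apply: (itu q x) => //; rewrite leNgt; apply/negP => xq; apply: nsx.
exact/(qs _ (tu_ _ tx)).
Qed.

(** [rho t] rises linearly from 0 to 1 on the interval of [t]; the intervals follow the order of the
    nodes, so a lower ramp is complete before a higher one starts. *)
Lemma wo_rat_ramps (u : wo_rat) : exists rho : wo_rat -> R -> R,
  [/\ forall t, continuous (rho t), forall t x, 0 <= rho t x <= 1,
      forall t x, x <= 0 -> rho t x = 0, forall t x, 1 <= x -> rho t x = 1 &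
      forall s t x, (s < t)%O -> (t <= u)%O -> 0 < rho t x -> rho s x = 1].
Proof.
have [l [r [lr rl]]] := wo_rat_intervals u.
pose y t x : R := (x - l t) / (r t - l t).
have y0 t x : x <= l t -> y t x <= 0.
  move=> xl; have [_ ltr _] := lr t.
  by rewrite /y mulr_le0_ge0 ?invr_ge0 ?subr_le0 ?subr_ge0 // ltW.
have y1 t x : r t <= x -> 1 <= y t x.
  by move=> rx; have [_ ltr _] := lr t; rewrite /y ler_pdivlMr ?subr_gt0 // mul1r; lra.
have full t x : r t <= x -> Num.max 0 (Num.min 1 (y t x)) = 1.
  by move=> /y1 yx; rewrite (min_idPl yx) (max_idPr _) // ler01.
have none t x : x <= l t -> Num.max 0 (Num.min 1 (y t x)) = 0.
  by move=> /y0 yx; apply/max_idPl; rewrite ge_min yx orbT.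
exists (fun t x => Num.max 0 (Num.min 1 (y t x))); split.
- move=> t x; apply: (@continuous_max R R (cst 0) (cst 1 \min y t)); first exact: cvg_cst.
  apply: (@continuous_min R R (cst 1) (y t)); first exact: cvg_cst.
  apply: (@continuousM R R (fun x => x - l t) (cst (r t - l t)^-1)); last exact: cvg_cst.
  by apply: (@continuousB R R R id (cst (l t))); [exact: cvg_id|exact: cvg_cst].
- by move=> t x; rewrite le_max lexx /= ge_max ler01 /= ge_min lexx.
- by move=> t x x0; apply: none; have [l0 _ _] := lr t; exact: le_trans l0.
- by move=> t x x1; apply: full; have [_ _ r1] := lr t; exact: le_trans x1.
- move=> s t x st tu; have [xl|lx] := leP x (l t); first by rewrite none // ltxx.
  by move=> _; apply: full; apply: le_trans (rl s t st tu) _; exact: ltW.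
Qed.

End Ramps.

(** * Path-connectedness of the space of soft branches *)

Section SoftBranchPaths.
Context {R : realType}.
Notation V := {ptws wo_rat -> R}.

(** The nodes of positive weight lie below one node [u]. Multiplying each weight by its ramp keeps
    [f] a soft branch, because nodes below an active one have full ramps. *)
Lemma soft_branch_contract (f : V) : soft_branch f -> exists gamma : R -> V,
  [/\ continuous gamma, forall x, soft_branch (gamma x),
      forall x, x <= 0 -> gamma x = (fun=> 0) & forall x, 1 <= x -> gamma x = f].
Proof.
move=> [f01 fdown fchain].
have [|u [_ uP]] := @wo_rat_sup [set t | 0 < f t].
  by move=> s t fs ft; apply/orP; exact: fchain.
have [rho [rho_cont rho01 rho0 rho1 rhoP]] := wo_rat_ramps (R := R) u.
have pos t x : 0 < f t * rho t x -> 0 < f t /\ 0 < rho t x.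
  have /andP[f0 _] := f01 t; have /andP[r0 _] := rho01 t x.
  move: f0 r0; rewrite !le_eqVlt => /predU1P[<-|->]; first by rewrite mul0r ltxx.
  by move=> /predU1P[<-|->] //; rewrite mulr0 ltxx.
exists (fun x t => f t * rho t x); split.
- apply: ptws_continuous => t x.
  apply: (@continuousM R R (cst (f t)) (rho t)); [exact: cvg_cst|exact: rho_cont].
- move=> x; split=> [t|s t st /pos[ft rt]|s t /pos[fs _] /pos[ft _]].
  + have /andP[f0 f1] := f01 t; have /andP[r0 r1] := rho01 t x.
    by rewrite mulr_ge0 ?mulr_ile1.
  + by rewrite (fdown s t) // (rhoP s t) ?mulr1 // uP.
  + exact: fchain.
- by move=> x x0; apply: functional_extensionality_dep => t; rewrite rho0 ?mulr0.
- by move=> x x1; apply: functional_extensionality_dep => t; rewrite rho1 ?mulr1.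
Qed.

Lemma soft_branch_path_connected :
  path_connected R (set_type (@soft_branch R _ wo_rat)).
Proof.
move=> x y.
have [gx [gx_cont gxP gx0 gx1]] := soft_branch_contract (set_valP x).
have [gy [gy_cont gyP gy0 gy1]] := soft_branch_contract (set_valP y).
(* The path runs from [x] to 0, then to [y]. At each time one summand vanishes, so continuity is
   that of a sum. *)
pose g (v : R) : V := fun t => gx (1 - 2 * v) t + gy (2 * v - 1) t.
have gl v : v <= 2^-1 -> g v = gx (1 - 2 * v).
  move=> v1; apply: functional_extensionality_dep => t.
  by rewrite /g [gy _]gy0 ?addr0 //; lra.
have gr v : 2^-1 <= v -> g v = gy (2 * v - 1).
  move=> v1; apply: functional_extensionality_dep => t.
  by rewrite /g [gx _]gx0 ?add0r //; lra.
have gP v : soft_branch (g v).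
  by have [vh|/ltW vh] := leP v 2^-1; [rewrite gl|rewrite gr].
have coord_cont (h : R -> V) (k : R -> R) t : continuous h -> continuous k ->
    continuous (fun v => h (k v) t).
  move=> ch ck v; apply: (@continuous_comp R V R (fun v => h (k v)) (fun f => f t)).
    by apply: (@continuous_comp R R V k h); [exact: ck|exact: ch].
  exact: ptws_coord_continuous.
have dbl_cont : continuous (fun v : R => 2 * v).
  by move=> v; apply: (@continuousM R R (cst 2) id); [exact: cvg_cst|exact: cvg_id].
have g_cont : continuous g.
  apply: ptws_continuous => t v.
  apply: (@continuousD R R R (fun v => gx (1 - 2 * v) t) (fun v => gy (2 * v - 1) t)).
    apply: (coord_cont gx (fun v => 1 - 2 * v)) => // w.
    by apply: (@continuousB R R R (cst 1) (fun v => 2 * v)); [exact: cvg_cst|exact: dbl_cont].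
  apply: (coord_cont gy (fun v => 2 * v - 1)) => // w.
  by apply: (@continuousB R R R (fun v => 2 * v) (cst 1)); [exact: dbl_cont|exact: cvg_cst].
exists (fun v => SigSub (mem_set (gP v))); split.
- apply: continuous_subspaceT; apply: set_type_continuous.
  by rewrite (_ : _ \o _ = g) //; apply: functional_extensionality_dep.
- by apply: val_inj; rewrite /= gl ?invr_ge0 // gx1 //; lra.
- by apply: val_inj; rewrite /= gr ?gy1 //; lra.
Qed.

End SoftBranchPaths.

(** * Cylinders and the pseudoclopens of soft branches *)

Section SoftBranchImage.
Context {R : realType} {d : Order.disp_t} {T : porderType d}.
Hypothesis treeT : is_tree T.
Notation L := (set_type (tree_space T)).
Notation K := (set_type (@soft_branch R d T)).

Lemma cylinder_inj : injective (@cylinder d T).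
Proof.
move=> s t st; apply: le_anti; have [x xP] := branchP treeT s; have [y yP] := branchP treeT t.
apply/andP; split; first by apply/yP; rewrite st; exact/yP.
by apply/xP; rewrite -st; exact/xP.
Qed.

Lemma tree_space_boolean_image : boolean_image L K.
Proof.
exists (range cylinder); split; first by move=> _ [t _ <-]; exact: cylinder_clopen.
  exact: cylinder_separates.
pose lo t : set K := [set f | set_val f t = 1].
pose hi t : set K := [set f | 0 < set_val f t].
(* [tau] recovers the node from its cylinder, which lets [phi] be defined on sets. *)
have /choice[tau tauP] (a : set L) : exists t : option T, forall s, a = cylinder s -> t = Some s.
  have [[s ->]|no] := pselect (exists s, a = cylinder s).
    by exists (Some s) => t /cylinder_inj ->.
  by exists None => s as_; case: no; exists s.
pose phi a : set K * set K := if tau a is Some t then (lo t, hi t) else (set0, set0).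
have phiE t : phi (cylinder t) = (lo t, hi t) by rewrite /phi (tauP _ t).
have coord_cont t : continuous (fun f : K => (set_val f : {ptws T -> R}) t).
  move=> f; apply: (@continuous_comp K {ptws T -> R} R set_val (fun f => f t)).
    exact: set_val_continuous.
  exact: ptws_coord_continuous.
have indicator (x : L) : exists f : K, forall t,
    (cylinder t x -> set_val f t = 1) /\ (~ cylinder t x -> set_val f t = 0).
  pose chi t : R := (`[< cylinder t x >])%:R.
  have chiE t : 0 < chi t -> cylinder t x.
    by rewrite /chi; case: asboolP => // _; rewrite ltxx.
  have Kchi : soft_branch chi.
    split=> [t|s t st /chiE xt|s t /chiE xs /chiE xt].
    - by rewrite /chi; case: asboolP; rewrite ?lexx ler01.
    - by rewrite /chi asboolT //; exact: (cylinder_down treeT (ltW st) xt).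
    - exact: (cylinder_comparable treeT xs xt).
  exists (SigSub (mem_set Kchi)) => t.
  change ((cylinder t x -> chi t = 1) /\ (~ cylinder t x -> chi t = 0)).
  by split=> xt; rewrite /chi; [rewrite asboolT|rewrite asboolF].
exists (phi @` range cylinder), phi; split.
  move=> _ [_ [t _ <-] <-]; rewrite phiE; split=> /=.
  - by apply: (@closed_comp K R (fun f => (set_val f : {ptws T -> R}) t) [set 1]) => [f _|];
      [exact: coord_cont|exact: closed_eq].
  - by apply: (@open_comp K R (fun f => (set_val f : {ptws T -> R}) t) [set r | 0 < r]) => [f _|];
      [exact: coord_cont|exact: open_gt].
  - by move=> f; rewrite /lo /hi /= => ->.
split.
  split; [by move=> a Ga; exists a| |by move=> _ [a Ga <-]; exists a].
  move=> a1 a2 /set_mem[s _ <-] /set_mem[t _ <-]; rewrite !phiE => -[lost _].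
  congr cylinder; apply: le_anti.
  have below u v : lo u = lo v -> (v <= u)%O.
    have [x xP] := branchP treeT u; have [f fP] := indicator x.
    have lof : lo u f by apply: (fP u).1; exact/xP.
    move=> uv; rewrite uv in lof; apply/xP; apply: contrapT => /(fP v).2.
    by move: lof; rewrite /lo /mkset => -> /eqP; rewrite oner_eq0.
  by rewrite !below.
move=> n m a b aG bG _ _ ab.
have /choice[s sP] i : exists t, a i = cylinder t by have [t _ <-] := aG i; exists t.
have /choice[t tP] j : exists t, b j = cylinder t by have [t _ <-] := bG j; exists t.
have st i j : s i <> t j by move=> E; apply: (ab i j); rewrite sP tP E.
split; apply: contraPP.
  move=> /eqP/set0P[f [fa fb]]; apply/eqP/set0P.
  have fs i : 0 < set_val f (s i) by have := fa i I; rewrite sP phiE.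
  have ft j : set_val f (t j) <> 1 by move=> f1; apply: fb; exists j => //; rewrite tP phiE.
  have [f01 fdown fchain] := set_valP f.
  pose above := fun v => 0 < set_val f v; pose full := fun v => set_val f v = 1.
  have mk (A : set T) : (forall v, A v -> 0 < set_val f v) -> down_closed A ->
      exists x : L, forall v, cylinder v x <-> A v.
    move=> Apos Adown; have Lx : tree_space T (fun v => `[< A v >]).
      apply/(tree_spaceP treeT); split=> [u v /asboolP Au /asboolP Av|u v uv /asboolP Av].
        by apply/orP; apply: fchain; exact: Apos.
      by apply/asboolP; exact: Adown Av.
    exists (SigSub (mem_set Lx)) => v; rewrite /cylinder /=.
    by split=> [/asboolP|Av] //; apply/asboolP.
  have full_above v : full v -> above v by rewrite /full /above => ->; exact: ltr01.
  have full_down : down_closed full.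
    move=> u v; rewrite le_eqVlt => /predU1P[->//|uv] /full_above; exact: fdown uv.
  have above_down : down_closed above.
    move=> u v; rewrite le_eqVlt => /predU1P[->//|uv] /(fdown u v uv); exact: full_above.
  (* If [t j] has a weight in ]0, 1[, each [s i] is comparable with it and different from it, hence
     below it and of weight 1: the nodes of weight 1 form the branch. Otherwise the nodes of
     positive weight do. *)
  have [[j fj]|no] := pselect (exists j, 0 < set_val f (t j)).
    have [x xP] := mk full full_above full_down.
    exists x; split=> [i _|[k _]]; last by rewrite tP => /xP; exact: ft.
    rewrite sP; apply/xP; have /orP[] := fchain _ _ (fs i) fj.
      rewrite le_eqVlt => /predU1P[/st//|sj]; exact: fdown sj fj.
    rewrite le_eqVlt => /predU1P[/esym/st//|js]; case: (ft j); exact: fdown js (fs i).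
  have [x xP] := mk above (fun v fv => fv) above_down.
  exists x; split=> [i _|[k _]]; first by rewrite sP; apply/xP; exact: fs.
  by rewrite tP => /xP fk; apply: no; exists k.
move=> /eqP/set0P[x [xa xb]]; apply/eqP/set0P.
have [f fP] := indicator x.
exists f; split=> [i _|[j _]].
  by rewrite sP phiE; apply: (fP (s i)).1; rewrite -sP; exact: xa.
have f0 : hi (t j) f -> set_val f (t j) = 0 -> False by rewrite /hi /mkset => + E; rewrite E ltxx.
rewrite tP phiE => fj; apply: xb; exists j => //; rewrite tP.
by apply: contrapT => /(fP (t j)).2; exact: f0.
Qed.

End SoftBranchImage.

(** * The positive and the negative assertion brought together *)

Theorem theorem5p4 (R : realType) :
  let L : topologicalType := set_type (tree_space wo_rat) in
  [/\ compact_space L /\ clopen_based L,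
      exists K : topologicalType,
        [/\ compact_space K, path_connected R K & boolean_image L K] &
      forall (Gamma : Type) (C : set {ptws Gamma -> R}),
        C !=set0 -> compact C -> @convex_set R (Gamma -> R^o) C ->
        ~ boolean_image L (set_type C)].
Proof.
have [bot bot_le] := wo_rat_bot; have treeT := wo_rat_is_tree; split.
- split; first exact: (tree_space_compact treeT bot).
  exact: (tree_space_clopen_based treeT bot).
- exists (set_type (@soft_branch R _ wo_rat)); split.
  + apply: set_type_compact_space; [exact/ptws_hausdorff/Rhausdorff|exact: soft_branch_compact|].
    exists (fun=> 0); split=> [t|s t _|s t]; rewrite ?ltxx //.
    by rewrite lexx ler01.
  + exact: soft_branch_path_connected.
  + exact: tree_space_boolean_image.
- move=> Gamma C _ cC convC.
  exact: (convex_not_boolean_image treeT wo_rat_countable_below bot_le wo_rat_not_special).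
Qed.
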